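(* Let $E$ be a directed graph and $R$ a commutative ring with $1$. Let $I$ and $J$ be ideals in $L_R(E)$, with corresponding pairs $(f_I,g_I)$ and $(f_J,g_J)$. Then the pair corresponding to the ideal $IJ$ is $(\overline{f_If_J+G_c^\times},\ g_Ig_J)$, where $G_c^\times:\mathscr{T}_E^*\to\mathcal{L}(R)$ is the function that maps $(\overline{c^0},\varnothing)$ to $(g_I(c)g_J(c))\cap R$ for each $c\in C_u(E)$, and every other element of $\mathscr{T}_E^*$ to the zero ideal.
   Context: Graphs. A directed graph $E=(E^0,E^1,r,s)$ has vertices $E^0$, edges $E^1$, and range and source maps $r,s:E^1\to E^0$ (arbitrary). A vertex $v$ is an infinite emitter if $s^{-1}(v)$ is infinite, and regular if $s^{-1}(v)$ is finite and nonempty. A path of positive length is $\mu=e_1\cdots e_n$ with $r(e_i)=s(e_{i+1})$; vertices are paths of length $0$; $\mu^0$ is the set of vertices of $\mu$. A path $e_1\cdots e_n$ with $n>0$ is closed if $s(e_1)=r(e_n)$; a closed path is simple if $s(e_i)=s(e_1)$ implies $i=1$, and a cycle if $s(e_i)=s(e_j)$ implies $i=j$. $L_R(E)$, the Leavitt path algebra, is the universal associative $R$-algebra generated by $E^0\cup E^1\cup\{e^*\mid e\in E^1\}$ subject to: $vw=\delta_{vw}v$; $s(e)e=e=er(e)$; $r(e)e^*=e^*=e^*s(e)$; $e^*f=\delta_{ef}r(e)$; $u=\sum_{e\in s^{-1}(u)}ee^*$ for regular $u$. Ideals are two-sided; $\mathcal{L}(A)$ is the set of ideals of a ring $A$. Admissible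 pairs. $H\subseteq E^0$ is hereditary if for every path $\mu$, $s(\mu)\in H$ implies $r(\mu)\in H$; saturated if for every regular $v$, $r(s^{-1}(v))\subseteq H$ implies $v\in H$. $\overline{K}$ is the smallest hereditary saturated subset containing $K\subseteq E^0$. A breaking vertex for a hereditary $H$ is an infinite emitter $v\in E^0\setminus H$ with $0<|s^{-1}(v)\cap r^{-1}(E^0\setminus H)|<\infty$; then $v^H=v-\sum_{e\in s^{-1}(v),\,r(e)\notin H}ee^*$. An admissible pair is $(H,S)$ with $H$ hereditary saturated and $S$ a set of breaking vertices for $H$. The set $\mathscr{T}_E$ of admissible pairs is ordered by $(H_1,S_1)\le(H_2,S_2)$ iff $H_1\subseteq H_2$ and $S_1\subseteq H_2\cup S_2$; it is a complete lattice. $\mathscr{T}_E^*=\mathscr{T}_E\setminus\{(\varnothing,\varnothing)\}$. Saturated functions. $\mathscr{F}_{E,R}$ is the set of functions $f:\mathscr{T}_E^*\to\mathcal{L}(R)$ with $f(\bigvee_i(H_i,S_i))=\bigcap_if(H_i,S_i)$ for all nonempty families in $\mathscr{T}_E^*$, ordered pointwise by inclusion. For a function $h:\mathscr{T}_E^*\to\mathcal{L}(R)$, its saturation $\overline{h}$ is the smallest element of $\mathscr{F}_{E,R}$ with $h(H,S)\subseteq\overline{h}(H,S)$ for all $(H,S)$. Sums and products of ideal-valued functions are pointwise. Cycles. Two cycles are equivalent if one is a cyclic rotation of the other. $C_u(E)$ is the set of equivalence classes of cycles $c$ such that there is exactly one closed simple path based at $s(c)=r(c)$; we write $c\in C_u(E)$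 for a representative. If $c$ is based at $v$ and $p(x)=\sum_na_nx^n\in R[x,x^{-1}]$, then $p(c)=\sum_{n<0}a_n(c^* )^{-n}+a_0v+\sum_{n>0}a_nc^n$, where $(e_1\cdots e_n)^*=e_n^*\cdots e_1^*$. The pair $(f_I,g_I)$ corresponding to an ideal $I$ of $L_R(E)$ is: $f_I(H,S)=\{r\in R\mid rv\in I\ \forall v\in H,\ rw^H\in I\ \forall w\in S\}$ for $(H,S)\in\mathscr{T}_E^*$, and $g_I(c)=\{p(x)\in R[x,x^{-1}]\mid p(c)\in I\}$ for $c\in C_u(E)$. *)

(* Defs.v *)
From HB Require Import structures.
From mathcomp Require Import all_boot all_order all_algebra.
From mathcomp Require Import generic_quotient.
From mathcomp Require Import all_classical.
From mathcomp Require Import finmap monalg.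

Set Implicit Arguments.
Unset Strict Implicit.
Unset Printing Implicit Defensive.

Import GRing.Theory.

Local Open Scope fset_scope.
Local Open Scope quotient_scope.
Local Open Scope classical_set_scope.
Local Open Scope ring_scope.

(* MathComp has no non-unital rings, and L_R(E) has no unit when E^0 is
   infinite: a ring is given here by its additive group and a product. *)
Section Ideals.
Context (A : zmodType) (op : A -> A -> A).

Definition ideal (I : set A) : Prop :=
  [/\ I 0, (forall x y, I x -> I y -> I (x - y))
    & forall a x, I x -> I (op a x) /\ I (op x a)].

Definition ideal_add (I J : set A) : set A :=
  [set z | exists x y, [/\ I x, J y & z = x + y]].

Definition ideal_mul (I J : set A) : set A :=
  [set z | exists n (x y : 'I_n -> A),
     [/\ forall i, I (x i), forall i, J (y i) & z = \sum_i op (x i) (y i)]].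

End Ideals.

(* R[x, x^-1]: {malg R[int]} is the group of finitely supported functions
   int -> R.  Its product in multinomials needs the exponents to form a monoid
   without invertible elements, so the convolution is defined here. *)
Definition laurent (R : comPzRingType) : Type := {malg R[int]}.

HB.instance Definition _ (R : comPzRingType) := GRing.Zmodule.on (laurent R).

Section Laurent.
Context (R : comPzRingType).
Implicit Types (p q : laurent R).

Definition lmono (a : R) (n : int) : laurent R := << a *g n >>.

Definition lconst (a : R) : laurent R := lmono a 0.

Definition lcoef (p : laurent R) (n : int) : R := p@_n.

Definition lsupp (p : laurent R) : {fset int} := msupp (p : {malg R[int]}).

Definition laurent_mul (p q : laurent R) : laurent R :=
  \sum_(m <- lsupp p) \sum_(n <- lsupp q) lmono (lcoef p m * lcoef q n) (m + n).

Lemma lmono0 n : lmono 0 n = 0.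
Proof. exact: (@monalgU0 int R n). Qed.

Lemma lmonoD a b n : lmono (a + b) n = lmono a n + lmono b n.
Proof. exact: (@monalgUD int R n a b). Qed.

Lemma lcoefD p q n : lcoef (p + q) n = lcoef p n + lcoef q n.
Proof. exact: (@mcoeffD int R n p q). Qed.

Lemma lcoef_out p n : n \notin lsupp p -> lcoef p n = 0.
Proof. exact: mcoeff_outdom. Qed.

Lemma laurentE p : p = \sum_(n <- lsupp p) lmono (lcoef p n) n.
Proof. exact: (@monalgE int R p). Qed.

Lemma laurent_mulw (d1 d2 : {fset int}) p q :
  (lsupp p `<=` d1)%fset -> (lsupp q `<=` d2)%fset ->
  laurent_mul p q =
  \sum_(m <- d1) \sum_(n <- d2) lmono (lcoef p m * lcoef q n) (m + n).
Proof.
move=> le1 le2; rewrite /laurent_mul (big_fset_incl _ le1) /=.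
  apply: eq_bigr => m _; apply: big_fset_incl => // n _ /lcoef_out ->.
  by rewrite mulr0 lmono0.
by move=> m _ /lcoef_out pm; rewrite big1 // => n _; rewrite pm mul0r lmono0.
Qed.

Lemma laurent_mulC : commutative laurent_mul.
Proof.
move=> p q; rewrite /laurent_mul exchange_big; apply: eq_bigr => n _.
by apply: eq_bigr => m _; rewrite mulrC addrC.
Qed.

Lemma laurent_mulDl : left_distributive laurent_mul +%R.
Proof.
move=> p q r; set d := (lsupp p `|` lsupp q)%fset.
have dp : (lsupp p `<=` d)%fset by exact: fsubsetUl.
have dq : (lsupp q `<=` d)%fset by exact: fsubsetUr.
have dpq : (lsupp (p + q)%R `<=` d)%fset by exact: msuppD_le.
rewrite (laurent_mulw dpq (fsubset_refl (lsupp r))).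
rewrite (laurent_mulw dp (fsubset_refl (lsupp r))).
rewrite (laurent_mulw dq (fsubset_refl (lsupp r))).
rewrite -big_split; apply: eq_bigr => m _.
rewrite -big_split; apply: eq_bigr => n _.
by rewrite /= lcoefD mulrDl lmonoD.
Qed.

Lemma laurent_mul0r : left_zero 0 laurent_mul.
Proof.
move=> p; apply: (@addrI _ (laurent_mul 0 p)).
by rewrite -laurent_mulDl !addr0.
Qed.

Lemma laurent_mulDr : right_distributive laurent_mul +%R.
Proof. by move=> p q r; rewrite !(laurent_mulC p) laurent_mulDl. Qed.

Lemma laurent_mulr0 : right_zero 0 laurent_mul.
Proof. by move=> p; rewrite laurent_mulC laurent_mul0r. Qed.

Lemma laurent_mulUU a b m n :
  laurent_mul (lmono a m) (lmono b n) = lmono (a * b) (m + n).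
Proof.
have le1 : (lsupp (lmono a m) `<=` [fset m])%fset by exact: msuppU_le.
have le2 : (lsupp (lmono b n) `<=` [fset n])%fset by exact: msuppU_le.
by rewrite (laurent_mulw le1 le2) !big_seq_fset1 /lcoef !mcoeffUU.
Qed.

Lemma laurent_mul1r : left_id (lconst 1) laurent_mul.
Proof.
move=> p; rewrite [in LHS](laurentE p).
rewrite (big_morph (laurent_mul _) (fun _ _ => laurent_mulDr _ _ _) (laurent_mulr0 _)).
rewrite [RHS]laurentE; apply: eq_bigr => n _.
by rewrite laurent_mulUU mul1r add0r.
Qed.

Lemma laurent_mulA : associative laurent_mul.
Proof.
have suml r := big_morph (laurent_mul^~ r) (fun _ _ => laurent_mulDl _ _ _) (laurent_mul0r r).
have sumr r := big_morph (laurent_mul r) (fun _ _ => laurent_mulDr _ _ _) (laurent_mulr0 r).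
move=> p q r; rewrite (laurentE p) (suml q) (suml (laurent_mul q r)) (suml r);
  apply: eq_bigr => k _.
rewrite (laurentE q) (suml r) (sumr (lmono _ k)) (sumr (lmono _ k)) (suml r);
   apply: eq_bigr => m _.
rewrite (laurentE r) (sumr (lmono _ m)) (sumr (lmono _ k)) (sumr (laurent_mul _ _)); apply: eq_bigr => n _.
by rewrite !laurent_mulUU mulrA addrA.
Qed.

HB.instance Definition _ := GRing.Zmodule_isComPzRing.Build (laurent R)
  laurent_mulA laurent_mulC laurent_mul1r laurent_mulDl.

End Laurent.

(* Classically (gen_choiceMixin) every type is a choiceType. *)
Record digraph := Digraph {
  vertex : choiceType;
  edge : choiceType;
  src : edge -> vertex;
  rng : edge -> vertex }.

Section Graphs.
Context (E : digraph).
Implicit Types (v w : vertex E) (e : edge E) (c p : seq (edge E)).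

Definition emitted v : set (edge E) := [set e | src e = v].

Definition infinite_emitter v : Prop := ~ finite_set (emitted v).

Definition regular v : Prop := finite_set (emitted v) /\ emitted v !=set0.

(* A path of positive length is a nonempty sequence e :: p such that
   path composable e p. *)
Definition composable : rel (edge E) := fun e e' => rng e == src e'.

Definition based_at v c : bool := if c is e :: _ then src e == v else false.

Definition closed_path c : bool :=
  if c is e :: p then path composable e p && (rng (last e p) == src e)
  else false.

Definition closed_simple_path c : bool :=
  closed_path c &&
  (if c is e :: p then src e \notin [seq src e' | e' <- p] else true).

Definition is_cycle c : bool :=
  closed_path c && uniq [seq src e | e <- c].

Definition path_vertices c : set (vertex E) :=
  [set v | exists2 e, e \in c & v = src e \/ v = rng e].

(* Representatives of the classes in C_u(E). *)
Definition Cu c : Prop :=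
  is_cycle c /\
  forall v, based_at v c -> exists! d, closed_simple_path d /\ based_at v d.

Definition hereditary (H : set (vertex E)) : Prop :=
  forall e p, path composable e p -> H (src e) -> H (rng (last e p)).

Definition saturated (H : set (vertex E)) : Prop :=
  forall v, regular v -> (forall e, emitted v e -> H (rng e)) -> H v.

Definition hersat_closure (K : set (vertex E)) : set (vertex E) :=
  smallest (fun H => hereditary H /\ saturated H) K.

Definition emitted_outside (H : set (vertex E)) v : set (edge E) :=
  [set e | emitted v e /\ ~ H (rng e)].

Definition breaking (H : set (vertex E)) v : Prop :=
  [/\ infinite_emitter v, ~ H v,
      emitted_outside H v !=set0 & finite_set (emitted_outside H v)].

Record admissible := Admissible {
  adH : set (vertex E);
  adS : set (vertex E);
  adH_hereditary : hereditary adH;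
  adH_saturated : saturated adH;
  adS_breaking : adS `<=` breaking adH }.

Definition admissible_le (P Q : admissible) : Prop :=
  adH P `<=` adH Q /\ adS P `<=` adH Q `|` adS Q.

(* The order is antisymmetric up to the proof components, so P is the join of X
   in the complete lattice of admissible pairs. *)
Definition is_join (X : set admissible) (P : admissible) : Prop :=
  (forall Q, X Q -> admissible_le Q P) /\
  forall P', (forall Q, X Q -> admissible_le Q P') -> admissible_le P P'.

Definition admissible_star : Type :=
  {P : admissible | ~ (adH P = set0 /\ adS P = set0)}.

End Graphs.

Section SaturatedFunctions.
Context (E : digraph) (R : comPzRingType).
Implicit Types (f h : admissible_star E -> set R).

Definition saturated_fun f : Prop :=
  (forall P, ideal *%R (f P)) /\
  forall (X : set (admissible_star E)) (P : admissible_star E),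
    X !=set0 -> is_join (sval @` X) (sval P) -> f P = \bigcap_(Q in X) f Q.

Definition fun_le f h : Prop := forall P, f P `<=` h P.

Definition saturation h : admissible_star E -> set R :=
  fun P => \bigcap_(f in [set f | saturated_fun f /\ fun_le h f]) f P.

Lemma saturationP h :
  [/\ saturated_fun (saturation h), fun_le h (saturation h)
    & forall f, saturated_fun f -> fun_le h f -> fun_le (saturation h) f].
Proof.
split; last by move=> f satf lehf P r; apply.
  split=> [P|X P X0 joinP].
    split=> [f [[/(_ P)[]]] //|x y hx hy f hf|a x hx].
      by case: (hf) => -[/(_ P)[_ + _] _ _]; apply; [exact: hx|exact: hy].
    split=> f hf; case: (hf) => -[/(_ P)[_ _ /(_ a x)] + _ _].
      by move=> /(_ (hx f hf))[].
    by move=> /(_ (hx f hf))[].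
  rewrite predeqE => r; split=> [hr Q XQ f hf|hr f hf].
    have := hr f hf; have [[_ satf] _] := hf.
    by rewrite (satf X P X0 joinP); apply.
  have [[_ satf] _] := hf.
  by rewrite (satf X P X0 joinP) => Q XQ; exact: hr.
by move=> P r hr f [_]; apply.
Qed.

End SaturatedFunctions.

(* The Leavitt path algebra, as the quotient of the formal expressions in the
   generators by the congruence generated by the axioms of associative, not
   necessarily unital, R-algebras and by the relations of the algebra. *)
Section LeavittPathAlgebra.
Context (R : comPzRingType) (E : digraph).

Inductive lpa_term :=
| TVertex of vertex E
| TEdge of edge E
| TGhost of edge E
| TZero
| TAdd of lpa_term & lpa_term
| TOpp of lpa_term
| TMul of lpa_term & lpa_term
| TScale of R & lpa_term.

HB.instance Definition _ := gen_eqMixin lpa_term.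
HB.instance Definition _ := gen_choiceMixin lpa_term.

Inductive lpa_cong : lpa_term -> lpa_term -> Prop :=
| cong_refl x : lpa_cong x x
| cong_sym x y : lpa_cong x y -> lpa_cong y x
| cong_trans y x z : lpa_cong x y -> lpa_cong y z -> lpa_cong x z
| cong_add x x' y y' : lpa_cong x x' -> lpa_cong y y' ->
    lpa_cong (TAdd x y) (TAdd x' y')
| cong_opp x x' : lpa_cong x x' -> lpa_cong (TOpp x) (TOpp x')
| cong_mul x x' y y' : lpa_cong x x' -> lpa_cong y y' ->
    lpa_cong (TMul x y) (TMul x' y')
| cong_scale a x x' : lpa_cong x x' -> lpa_cong (TScale a x) (TScale a x')
| cong_addA x y z : lpa_cong (TAdd x (TAdd y z)) (TAdd (TAdd x y) z)
| cong_addC x y : lpa_cong (TAdd x y) (TAdd y x)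
| cong_add0 x : lpa_cong (TAdd TZero x) x
| cong_addN x : lpa_cong (TAdd (TOpp x) x) TZero
| cong_scaleA a b x : lpa_cong (TScale a (TScale b x)) (TScale (a * b) x)
| cong_scale1 x : lpa_cong (TScale 1 x) x
| cong_scaleDr a x y :
    lpa_cong (TScale a (TAdd x y)) (TAdd (TScale a x) (TScale a y))
| cong_scaleDl a b x :
    lpa_cong (TScale (a + b) x) (TAdd (TScale a x) (TScale b x))
| cong_mulA x y z : lpa_cong (TMul x (TMul y z)) (TMul (TMul x y) z)
| cong_mulDl x y z : lpa_cong (TMul (TAdd x y) z) (TAdd (TMul x z) (TMul y z))
| cong_mulDr x y z : lpa_cong (TMul x (TAdd y z)) (TAdd (TMul x y) (TMul x z))
| cong_scaleAl a x y : lpa_cong (TMul (TScale a x) y) (TScale a (TMul x y))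
| cong_scaleAr a x y : lpa_cong (TMul x (TScale a y)) (TScale a (TMul x y))
| cong_vv v : lpa_cong (TMul (TVertex v) (TVertex v)) (TVertex v)
| cong_vw v w : v != w -> lpa_cong (TMul (TVertex v) (TVertex w)) TZero
| cong_src_e e : lpa_cong (TMul (TVertex (src e)) (TEdge e)) (TEdge e)
| cong_e_rng e : lpa_cong (TMul (TEdge e) (TVertex (rng e))) (TEdge e)
| cong_rng_g e : lpa_cong (TMul (TVertex (rng e)) (TGhost e)) (TGhost e)
| cong_g_src e : lpa_cong (TMul (TGhost e) (TVertex (src e))) (TGhost e)
| cong_ge e : lpa_cong (TMul (TGhost e) (TEdge e)) (TVertex (rng e))
| cong_gf e f : e != f -> lpa_cong (TMul (TGhost e) (TEdge f)) TZero
(* u is regular exactly when s^-1(u) is enumerated by a nonempty list. *)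
| cong_regular u (s : seq (edge E)) :
    s != [::] -> uniq s -> (forall e, (e \in s) = (src e == u)) ->
    lpa_cong (TVertex u)
      (foldr (fun e => TAdd (TMul (TEdge e) (TGhost e))) TZero s).

Definition lpa_congb (x y : lpa_term) : bool := `[< lpa_cong x y >].

Lemma lpa_congb_refl : reflexive lpa_congb.
Proof. by move=> x; apply/asboolP; exact: cong_refl. Qed.

Lemma lpa_congb_sym : symmetric lpa_congb.
Proof. by move=> x y; apply/asboolP/asboolP; exact: cong_sym. Qed.

Lemma lpa_congb_trans : transitive lpa_congb.
Proof.
move=> y x z /asboolP xy /asboolP yz; apply/asboolP; exact: cong_trans xy yz.
Qed.

Canonical lpa_equiv :=
  EquivRel lpa_congb lpa_congb_refl lpa_congb_sym lpa_congb_trans.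

Definition lpa : Type := {eq_quot lpa_equiv}.

HB.instance Definition _ := Choice.on lpa.

Definition lpa_class (x : lpa_term) : lpa := \pi_{eq_quot lpa_equiv} x.

Definition lpa_repr (x : lpa) : lpa_term := repr (x : {eq_quot lpa_equiv}).

Lemma lpa_classP x y : lpa_class x = lpa_class y <-> lpa_cong x y.
Proof.
split=> [h|h]; last by apply/eqmodP; apply/asboolP.
by move/eqmodP: h => /asboolP.
Qed.

Lemma lpa_reprK x : lpa_class (lpa_repr x) = x.
Proof. exact: reprK. Qed.

Lemma lpa_repr_class x : lpa_cong (lpa_repr (lpa_class x)) x.
Proof. by apply/lpa_classP; rewrite lpa_reprK. Qed.

Lemma lpaW (P : lpa -> Prop) : (forall x, P (lpa_class x)) -> forall x, P x.
Proof. by move=> h x; rewrite -(lpa_reprK x). Qed.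

Definition lpa_vertex (v : vertex E) : lpa := lpa_class (TVertex v).
Definition lpa_edge (e : edge E) : lpa := lpa_class (TEdge e).
Definition lpa_ghost (e : edge E) : lpa := lpa_class (TGhost e).
Definition lpa_zero : lpa := lpa_class TZero.
Definition lpa_add (x y : lpa) : lpa :=
  lpa_class (TAdd (lpa_repr x) (lpa_repr y)).
Definition lpa_opp (x : lpa) : lpa := lpa_class (TOpp (lpa_repr x)).
Definition lpa_mul (x y : lpa) : lpa :=
  lpa_class (TMul (lpa_repr x) (lpa_repr y)).
Definition lpa_scale (a : R) (x : lpa) : lpa :=
  lpa_class (TScale a (lpa_repr x)).

Lemma lpa_class_add x y :
  lpa_class (TAdd x y) = lpa_add (lpa_class x) (lpa_class y).
Proof.
by apply/lpa_classP/cong_add; apply: cong_sym; exact: lpa_repr_class.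
Qed.

Lemma lpa_class_opp x : lpa_class (TOpp x) = lpa_opp (lpa_class x).
Proof. by apply/lpa_classP/cong_opp; apply: cong_sym; exact: lpa_repr_class. Qed.

Lemma lpa_class_mul x y :
  lpa_class (TMul x y) = lpa_mul (lpa_class x) (lpa_class y).
Proof.
by apply/lpa_classP/cong_mul; apply: cong_sym; exact: lpa_repr_class.
Qed.

Lemma lpa_class_scale a x :
  lpa_class (TScale a x) = lpa_scale a (lpa_class x).
Proof.
by apply/lpa_classP/cong_scale; apply: cong_sym; exact: lpa_repr_class.
Qed.

Definition lpa_classE :=
  (lpa_class_add, lpa_class_opp, lpa_class_mul, lpa_class_scale).

Lemma lpa_addA : associative lpa_add.
Proof.
elim/lpaW=> x; elim/lpaW=> y; elim/lpaW=> z.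
by rewrite -!lpa_classE; apply/lpa_classP; exact: cong_addA.
Qed.

Lemma lpa_addC : commutative lpa_add.
Proof.
elim/lpaW=> x; elim/lpaW=> y.
by rewrite -!lpa_classE; apply/lpa_classP; exact: cong_addC.
Qed.

Lemma lpa_add0 : left_id lpa_zero lpa_add.
Proof.
by elim/lpaW=> x; rewrite -!lpa_classE; apply/lpa_classP; exact: cong_add0.
Qed.

Lemma lpa_addN : left_inverse lpa_zero lpa_opp lpa_add.
Proof.
by elim/lpaW=> x; rewrite -!lpa_classE; apply/lpa_classP; exact: cong_addN.
Qed.

HB.instance Definition _ :=
  GRing.isZmodule.Build lpa lpa_addA lpa_addC lpa_add0 lpa_addN.

Lemma lpa_scaleA a b x : lpa_scale a (lpa_scale b x) = lpa_scale (a * b) x.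
Proof.
elim/lpaW: x => x; rewrite -!lpa_classE; apply/lpa_classP; exact: cong_scaleA.
Qed.

Lemma lpa_scale1 : left_id 1 lpa_scale.
Proof.
by elim/lpaW=> x; rewrite -!lpa_classE; apply/lpa_classP; exact: cong_scale1.
Qed.

Lemma lpa_scaleDr : right_distributive lpa_scale +%R.
Proof.
move=> a; elim/lpaW=> x; elim/lpaW=> y; rewrite /GRing.add /= -!lpa_classE.
apply/lpa_classP; exact: cong_scaleDr.
Qed.

Lemma lpa_scaleDl x : {morph lpa_scale^~ x : a b / a + b}.
Proof.
move=> a b; elim/lpaW: x => x; rewrite {2}/GRing.add /= -!lpa_classE.
apply/lpa_classP; exact: cong_scaleDl.
Qed.

HB.instance Definition _ := GRing.Zmodule_isLmodule.Build R lpa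
  lpa_scaleA lpa_scale1 lpa_scaleDr lpa_scaleDl.

Lemma lpa_mulA : associative lpa_mul.
Proof.
elim/lpaW=> x; elim/lpaW=> y; elim/lpaW=> z.
by rewrite -!lpa_classE; apply/lpa_classP; exact: cong_mulA.
Qed.

Lemma lpa_mulDl : left_distributive lpa_mul +%R.
Proof.
elim/lpaW=> x; elim/lpaW=> y; elim/lpaW=> z.
by rewrite /GRing.add /= -!lpa_classE; apply/lpa_classP; exact: cong_mulDl.
Qed.

Lemma lpa_mulDr : right_distributive lpa_mul +%R.
Proof.
elim/lpaW=> x; elim/lpaW=> y; elim/lpaW=> z.
by rewrite /GRing.add /= -!lpa_classE; apply/lpa_classP; exact: cong_mulDr.
Qed.

Lemma lpa_scaleAl a x y : lpa_mul (a *: x) y = a *: lpa_mul x y.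
Proof.
elim/lpaW: x => x; elim/lpaW: y => y.
by rewrite /GRing.scale /= -!lpa_classE; apply/lpa_classP; exact: cong_scaleAl.
Qed.

Lemma lpa_scaleAr a x y : lpa_mul x (a *: y) = a *: lpa_mul x y.
Proof.
elim/lpaW: x => x; elim/lpaW: y => y.
by rewrite /GRing.scale /= -!lpa_classE; apply/lpa_classP; exact: cong_scaleAr.
Qed.

End LeavittPathAlgebra.

(* The relations imposed on the images of the generators in an algebra. *)
Record leavitt_family (R : comPzRingType) (E : digraph) (A : lmodType R)
    (op : A -> A -> A) (V : vertex E -> A) (X G : edge E -> A) : Prop := {
  lf_vw : forall v w, op (V v) (V w) = if v == w then V v else 0;
  lf_src_e : forall e, op (V (src e)) (X e) = X e;
  lf_e_rng : forall e, op (X e) (V (rng e)) = X e;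
  lf_rng_g : forall e, op (V (rng e)) (G e) = G e;
  lf_g_src : forall e, op (G e) (V (src e)) = G e;
  lf_ge : forall e f, op (G e) (X f) = if e == f then V (rng e) else 0;
  lf_regular : forall u, regular u ->
    V u = \sum_(e \in emitted u) op (X e) (G e) }.

Section UniversalProperty.
Context (R : comPzRingType) (E : digraph).

Lemma emitted_enum (u : vertex E) : regular u ->
  exists s : seq (edge E),
    [/\ s != [::], uniq s & forall e, (e \in s) = (src e == u)].
Proof.
case=> fu [e0 e0u]; exists (fset_set (emitted u)).
have memP e : (e \in fset_set (emitted u)) = (src e == u).
  rewrite in_fset_set //; apply/idP/idP => [/set_mem <- //|/eqP eu].
  exact: mem_set.
split=> //; apply/eqP => s0; have := memP e0.
by rewrite (eqP (introT eqP e0u)) eqxx -[_ \in _]/(e0 \in enum_fset _) s0.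
Qed.

Lemma emitted_sum (A : zmodType) (F : edge E -> A) (u : vertex E)
    (s : seq (edge E)) :
  uniq s -> (forall e, (e \in s) = (src e == u)) ->
  \sum_(e \in emitted u) F e = \sum_(e <- s) F e.
Proof.
move=> us sP; rewrite (_ : emitted u = [set` s]); first by rewrite -fsbig_seq.
rewrite predeqE => e; rewrite /= sP; split=> [->|/eqP //]; exact: eqxx.
Qed.

Lemma lpa_leavitt_family :
  leavitt_family (@lpa_mul R E) (@lpa_vertex R E) (@lpa_edge R E) (@lpa_ghost R E).
Proof.
split=> [v w|e|e|e|e|e f|u ru]; try (rewrite -lpa_class_mul; apply/lpa_classP;
  by [exact: cong_src_e|exact: cong_e_rng|exact: cong_rng_g|exact: cong_g_src]).
- case: eqVneq => [->|vw]; rewrite -lpa_class_mul; apply/lpa_classP;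
    [exact: cong_vv|exact: cong_vw].
- case: eqVneq => [->|vw]; rewrite -lpa_class_mul; apply/lpa_classP;
    [exact: cong_ge|exact: cong_gf].
- have [s [s0 us sP]] := emitted_enum ru; rewrite (emitted_sum _ us sP).
  rewrite /lpa_vertex; have /lpa_classP -> := cong_regular R s0 us sP.
  elim: s {s0 us sP} => [|e s IH]; first by rewrite big_nil.
  by rewrite big_cons /= lpa_class_add IH lpa_class_mul.
Qed.

Lemma lpa_universal (A : lmodType R) (op : A -> A -> A)
    (V : vertex E -> A) (X G : edge E -> A) :
  associative op -> left_distributive op +%R -> right_distributive op +%R ->
  (forall a x y, op (a *: x) y = a *: op x y) ->
  (forall a x y, op x (a *: y) = a *: op x y) ->
  leavitt_family op V X G ->
  exists! phi : lpa R E -> A,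
    [/\ forall a x y, phi (a *: x + y) = a *: phi x + phi y,
        forall x y, phi (lpa_mul x y) = op (phi x) (phi y),
        forall v, phi (lpa_vertex R v) = V v,
        forall e, phi (lpa_edge R e) = X e
      & forall e, phi (lpa_ghost R e) = G e].
Proof.
move=> opA opDl opDr opZl opZr fam.
pose ev := fix ev (t : lpa_term R E) : A := match t with
  | TVertex v => V v | TEdge e => X e | TGhost e => G e | TZero => 0
  | TAdd x y => ev x + ev y | TOpp x => - ev x
  | TMul x y => op (ev x) (ev y) | TScale a x => a *: ev x end.
have evP x y : lpa_cong x y -> ev x = ev y.
  elim=> //=; try by move=> *; congruence.
  - by move=> *; rewrite addrA.
  - by move=> *; exact: addrC.
  - by move=> *; rewrite add0r.
  - by move=> *; rewrite addNr.
  - by move=> *; rewrite scalerA.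
  - by move=> *; rewrite scale1r.
  - by move=> *; rewrite scalerDr.
  - by move=> *; rewrite scalerDl.
  - by move=> v; rewrite (lf_vw fam) eqxx.
  - by move=> v w vw; rewrite (lf_vw fam) (negPf vw).
  - exact: (lf_src_e fam).
  - exact: (lf_e_rng fam).
  - exact: (lf_rng_g fam).
  - exact: (lf_g_src fam).
  - by move=> e; rewrite (lf_ge fam) eqxx.
  - by move=> e f ef; rewrite (lf_ge fam) (negPf ef).
  - move=> u s s0 us sP.
    have setE : emitted u = [set` s].
      by rewrite predeqE => e; rewrite /= sP; split=> [->|/eqP //]; exact: eqxx.
    have ru : regular u.
      split; first by rewrite setE; exact: finite_seq.
      by case: s s0 {us sP} setE => // e s _ ->; exists e; rewrite /= mem_head.
    rewrite (lf_regular fam ru) (emitted_sum _ us sP).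
    elim: s {s0 us sP setE} => [|e s IH]; first by rewrite big_nil.
    by rewrite big_cons IH.
pose phi (x : lpa R E) := ev (lpa_repr x).
have phiE t : phi (lpa_class t) = ev t by apply: evP; exact: lpa_repr_class.
exists phi; split.
  split=> [a x y|x y|v|e|e]; try exact: phiE.
  elim/lpaW: x => x; elim/lpaW: y => y.
  have -> : a *: lpa_class x + lpa_class y = lpa_class (TAdd (TScale a x) y).
    by rewrite lpa_class_add lpa_class_scale.
  by rewrite !phiE.
move=> psi [psiL psiM psiV psiX psiG]; apply/funext; elim/lpaW=> t; rewrite phiE.
have psi0 : psi 0 = 0.
  have := psiL 1 0 0; rewrite !scale1r !addr0 => h.
  by apply: (@addrI _ (psi 0)); rewrite -h addr0.
have psiD x y : psi (x + y) = psi x + psi y by rewrite -[x]scale1r psiL !scale1r.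
have psiZ a x : psi (a *: x) = a *: psi x by rewrite -[a *: x]addr0 psiL psi0 addr0.
have psiN x : psi (- x) = - psi x by rewrite -!scaleN1r psiZ.
elim: t => /= [v|e|e||x -> y ->|x ->|x -> y ->|a x ->]; rewrite ?lpa_classE.
- by rewrite -psiV.
- by rewrite -psiX.
- by rewrite -psiG.
- by rewrite -psi0.
- by rewrite -psiD.
- by rewrite -psiN.
- by rewrite -psiM.
- by rewrite -psiZ.
Qed.

End UniversalProperty.

Section CorrespondingPair.
Context (R : comPzRingType) (E : digraph).
Implicit Types (I J : set (lpa R E)) (c : seq (edge E)).

(* Product of a nonempty list of elements; lpa has no unit, and the value on
   the empty list is never used. *)
Definition lpa_prod (s : seq (lpa R E)) : lpa R E :=
  if s is x :: s' then foldl (@lpa_mul R E) x s' else 0.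

Definition lpa_path c : lpa R E := lpa_prod [seq lpa_edge R e | e <- c].

Definition lpa_path_ghost c : lpa R E :=
  lpa_prod (rev [seq lpa_ghost R e | e <- c]).

Definition lpa_base c : lpa R E :=
  if c is e :: _ then lpa_vertex R (src e) else 0.

(* c^n for n > 0, the base vertex of c for n = 0, and (c^* )^(-n) for n < 0;
   Negz n stands for - (n + 1). *)
Definition lpa_cycle_pow c (n : int) : lpa R E :=
  match n with
  | Posz 0 => lpa_base c
  | Posz n'.+1 => lpa_prod (nseq n'.+1 (lpa_path c))
  | Negz n' => lpa_prod (nseq n'.+1 (lpa_path_ghost c))
  end.

Definition lpa_eval (p : laurent R) c : lpa R E :=
  \sum_(n <- lsupp p) lcoef p n *: lpa_cycle_pow c n.

Definition lpa_breaking (H : set (vertex E)) (w : vertex E) : lpa R E :=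
  lpa_vertex R w -
  \sum_(e \in emitted_outside H w) lpa_mul (lpa_edge R e) (lpa_ghost R e).

Definition pair_f I (P : admissible_star E) : set R :=
  [set r | (forall v, adH (sval P) v -> I (r *: lpa_vertex R v)) /\
           (forall w, adS (sval P) w -> I (r *: lpa_breaking (adH (sval P)) w))].

Definition pair_g I c : set (laurent R) := [set p | I (lpa_eval p c)].

(* The zero ideal, together with (g1(c) g2(c)) \cap R if P is the pair of some
   c in C_u(E).  Such a c is unique up to rotation (equal closures force two
   cycles of C_u(E) to reach one another), and pair_g does not change under
   rotation, so at most one value is ever added to the zero ideal. *)
Definition Gc (g1 g2 : seq (edge E) -> set (laurent R))
    (P : admissible_star E) : set R :=
  [set r | r = 0 \/
    exists c, [/\ Cu c,
      adH (sval P) = hersat_closure (path_vertices c), adS (sval P) = set0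
      & ideal_mul *%R (g1 c) (g2 c) (lconst r)]].

End CorrespondingPair.

(* Main.v *)
(* Let r v lie in IJ, so r v = sum_i x_i y_i with x_i in I and y_i in J.  If mu
   is a long path from v to u, then mu^* x_i is a combination of ghost paths and
   y_i mu one of paths, all ending at u, and r u = sum_i (mu^* x_i)(y_i mu).  If
   u is the base of no closed simple path, or of at least two, multiplying by
   t^* and t for a suitable closed path t at u kills all products of distinct
   paths, so that r is a sum of products s t' with s u in I and t' u in J.  If u
   is the base of exactly one, that path is a cycle c in C_u(E), and grouping
   the paths by their first arrival at u gives r in g_I(c) g_J(c).  At a singular
   vertex w the elements w - sum_{e in F} e e^*, with F finite and large, play
   the role of t^* and t.  Hence any saturated function above f_I f_J + G contains r
   at every vertex reached by a long path, and by saturation, going backwards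
   along paths, at v.  The grouping argument also gives the equality for g.
   The converse inclusions rest on the fact that f is saturated iff, for each r,
   the pairs P with r in f(P) are those below one admissible pair; for f_I it is
   ({v | r v in I}, {w | r w^H in I}).  Linear independence comes from a graded
   representation of L_R(E) on functions on boundary paths. *)
Require Import Defs.
From mathcomp Require Import all_boot all_order all_algebra.
From mathcomp Require Import all_classical.
From mathcomp Require Import finmap zify.
Import GRing.Theory.
Local Open Scope classical_set_scope.
Local Open Scope ring_scope.

Set Implicit Arguments.
Unset Strict Implicit.
Unset Printing Implicit Defensive.

Local Notation "x ** y" := (lpa_mul x y) (at level 40, left associativity).

(** * Bilinearity of the product of L_R(E) *)

Section Arithmetic.
Context (R : comPzRingType) (E : digraph).
Implicit Types (x y z : lpa R E).

Lemma lpa_mul0l x : 0 ** x = 0.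
Proof. by apply: (@addrI _ (0 ** x)); rewrite -lpa_mulDl !addr0. Qed.

Lemma lpa_mul0r x : x ** 0 = 0.
Proof. by apply: (@addrI _ (x ** 0)); rewrite -lpa_mulDr !addr0. Qed.

Lemma lpa_mulNl x y : (- x) ** y = - (x ** y).
Proof. by rewrite -[- x]scaleN1r lpa_scaleAl scaleN1r. Qed.

Lemma lpa_mulNr x y : x ** (- y) = - (x ** y).
Proof. by rewrite -[- y]scaleN1r lpa_scaleAr scaleN1r. Qed.

Lemma lpa_mulBl x y z : (x - y) ** z = x ** z - y ** z.
Proof. by rewrite lpa_mulDl lpa_mulNl. Qed.

Lemma lpa_mulBr x y z : x ** (y - z) = x ** y - x ** z.
Proof. by rewrite lpa_mulDr lpa_mulNr. Qed.

Lemma lpa_suml T (s : seq T) (P : pred T) (F : T -> lpa R E) x :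
  (\sum_(i <- s | P i) F i) ** x = \sum_(i <- s | P i) F i ** x.
Proof. by apply: (big_morph (fun y => y ** x)) => [y z|]; rewrite (lpa_mulDl, lpa_mul0l). Qed.

Lemma lpa_sumr T (s : seq T) (P : pred T) (F : T -> lpa R E) x :
  x ** (\sum_(i <- s | P i) F i) = \sum_(i <- s | P i) x ** F i.
Proof. by apply: (big_morph (fun y => x ** y)) => [y z|]; rewrite (lpa_mulDr, lpa_mul0r). Qed.

End Arithmetic.

(** * Paths between given vertices *)

Section Paths.
Context (E : digraph).
Implicit Types (u v w : vertex E) (e f : edge E) (p q : seq (edge E)).

(** Both ends are arguments, so that [[::]] serves as the path of length zero at every vertex. *)
Fixpoint epath v p w : bool :=
  if p is e :: p' then (src e == v) && epath (rng e) p' w else v == w.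

Lemma epath_cat v p z q w : epath v p z -> epath v (p ++ q) w = epath z q w.
Proof.
elim: p v => [|e p IH] v /=; first by move/eqP->.
by case/andP=> -> /IH ->.
Qed.

Lemma epath_split v p q w :
  epath v (p ++ q) w -> exists2 z, epath v p z & epath z q w.
Proof.
elim: p v => [|e p IH] v /=; first by exists v.
by case/andP=> -> /IH.
Qed.

End Paths.

(** * Paths and ghost paths as elements of L_R(E), and their span *)

Section PathElements.
Context (R : comPzRingType) (E : digraph).
Implicit Types (u v w : vertex E) (e f : edge E) (p q : seq (edge E)).
Local Notation V := (@lpa_vertex R E).
Local Notation X := (@lpa_edge R E).
Local Notation G := (@lpa_ghost R E).

(** The vertex argument matters only for [[::]], where the list alone cannot determine the
    element. *)
Fixpoint pel v p : lpa R E :=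
  if p is e :: p' then X e ** pel (rng e) p' else V v.

Fixpoint gel v p : lpa R E :=
  if p is e :: p' then gel (rng e) p' ** G e else V v.

Let fam := lpa_leavitt_family R E.

Lemma mul_vv v : V v ** V v = V v.
Proof. by rewrite (lf_vw fam) eqxx. Qed.

Lemma mul_vw v w : v != w -> V v ** V w = 0.
Proof. by rewrite (lf_vw fam) => /negPf->. Qed.

Lemma mul_ge e : G e ** X e = V (rng e).
Proof. by rewrite (lf_ge fam) eqxx. Qed.

Lemma mul_gf e f : e != f -> G e ** X f = 0.
Proof. by rewrite (lf_ge fam) => /negPf->. Qed.

Lemma mul_src_edge e : V (src e) ** X e = X e. Proof. exact: lf_src_e fam e. Qed.
Lemma mul_edge_rng e : X e ** V (rng e) = X e. Proof. exact: lf_e_rng fam e. Qed.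
Lemma mul_rng_ghost e : V (rng e) ** G e = G e. Proof. exact: lf_rng_g fam e. Qed.
Lemma mul_ghost_src e : G e ** V (src e) = G e. Proof. exact: lf_g_src fam e. Qed.

Lemma mul_v_pel v p w : epath v p w -> V v ** pel v p = pel v p.
Proof.
case: p => [|e p] /=; first by rewrite mul_vv.
by case/andP=> /eqP <- _; rewrite lpa_mulA mul_src_edge.
Qed.

Lemma mul_pel_v v p w : epath v p w -> pel v p ** V w = pel v p.
Proof.
elim: p v => [|e p IH] v /=; first by move/eqP->; rewrite mul_vv.
by case/andP=> _ /IH h; rewrite -lpa_mulA h.
Qed.

Lemma mul_gel_v v p w : epath v p w -> gel v p ** V v = gel v p.
Proof.
case: p => [|e p] /=; first by rewrite mul_vv.
by case/andP=> /eqP <- _; rewrite -lpa_mulA mul_ghost_src.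
Qed.

Lemma pel_cat v p w q z :
  epath v p w -> epath w q z -> pel v (p ++ q) = pel v p ** pel w q.
Proof.
move=> + qz; elim: p v => [|e p IH] v /=; first by move/eqP->; rewrite (mul_v_pel qz).
by case/andP=> _ /IH ->; rewrite lpa_mulA.
Qed.

Lemma gel_cat v p w q z :
  epath v p w -> epath w q z -> gel v (p ++ q) = gel w q ** gel v p.
Proof.
move=> + qz; elim: p v => [|e p IH] v /=; first by move/eqP->; rewrite (mul_gel_v qz).
by case/andP=> _ /IH ->; rewrite lpa_mulA.
Qed.

Lemma gel_pel v p w : epath v p w -> gel v p ** pel v p = V w.
Proof.
elim: p v => [|e p IH] v /=; first by move/eqP->; rewrite mul_vv.
case/andP=> _ h; rewrite -lpa_mulA (lpa_mulA (G e)) mul_ge (mul_v_pel h).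
exact: IH.
Qed.

Lemma gel_pel_cat v p w q z :
  epath v p w -> epath w q z -> gel v p ** pel v (p ++ q) = pel w q.
Proof.
by move=> h h'; rewrite (pel_cat h h') lpa_mulA (gel_pel h) (mul_v_pel h').
Qed.

Lemma gel_cat_pel v p w q z :
  epath v p w -> epath w q z -> gel v (p ++ q) ** pel v p = gel w q.
Proof.
by move=> h h'; rewrite (gel_cat h h') -lpa_mulA (gel_pel h) (mul_gel_v h').
Qed.

(** Past their common beginning the two paths go on by distinct edges e and f, and e^* f = 0. *)
Lemma gel_pel_incomparable v p w q z : epath v p w -> epath v q z ->
  ~~ prefix p q -> ~~ prefix q p -> gel v p ** pel v q = 0.
Proof.
elim: p v q => [|e p IH] v [|f q] //= /andP[_ hp] /andP[_ hq].
rewrite (eq_sym f); case: eqVneq => [ef|ef _ _] /=.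
  rewrite -{}ef in hq *; move=> pq qp.
  rewrite -lpa_mulA (lpa_mulA (G e)) mul_ge (mul_v_pel hq).
  exact: IH hp hq pq qp.
by rewrite -lpa_mulA (lpa_mulA (G e)) (mul_gf ef) lpa_mul0l lpa_mul0r.
Qed.

Lemma gel_pel_start v p w v' q z : epath v p w -> epath v' q z -> v != v' ->
  gel v p ** pel v' q = 0.
Proof.
move=> hp hq vv'; rewrite -(mul_gel_v hp) -(mul_v_pel hq) -lpa_mulA (lpa_mulA (V v)).
by rewrite (mul_vw vv') lpa_mul0l lpa_mul0r.
Qed.

(** The span of the elements p q^* with p and q ending at the same vertex; the inductive form
    reduces proofs about the whole algebra to three cases. *)
Inductive monomial_sum : lpa R E -> Prop :=
| monomial_sum0 : monomial_sum 0
| monomial_sumD x y : monomial_sum x -> monomial_sum y -> monomial_sum (x + y)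
| monomial_sumM s v p v' q w : epath v p w -> epath v' q w ->
    monomial_sum (s *: (pel v p ** gel v' q)).

Lemma monomial_sumZ s x : monomial_sum x -> monomial_sum (s *: x).
Proof.
elim=> [|y z _ hy _ hz|t v p v' q w hp hq].
- by rewrite scaler0; exact: monomial_sum0.
- by rewrite scalerDr; exact: monomial_sumD.
- by rewrite scalerA; exact: monomial_sumM hp hq.
Qed.

(** In p q^* p1 q1^* the middle q^* p1 vanishes unless q and p1 start together and one is a prefix
    of the other; the remainder then lengthens p or q1. *)
Lemma monomial_sum_mul x y : monomial_sum x -> monomial_sum y -> monomial_sum (x ** y).
Proof.
move=> hx hy; elim: hx => [|x1 x2 _ h1 _ h2|s v p v' q w hp hq].
- by rewrite lpa_mul0l; exact: monomial_sum0.
- by rewrite lpa_mulDl; exact: monomial_sumD.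
elim: hy => [|y1 y2 _ h1 _ h2|t v1 p1 v2 q1 w1 hp1 hq1].
- by rewrite lpa_mul0r; exact: monomial_sum0.
- by rewrite lpa_mulDr; exact: monomial_sumD.
rewrite lpa_scaleAl lpa_scaleAr; do 2!apply: monomial_sumZ.
rewrite -lpa_mulA (lpa_mulA (gel v' q)).
have [ev|nv] := eqVneq v' v1; last first.
  rewrite (gel_pel_start hq hp1 nv) lpa_mul0l lpa_mul0r; exact: monomial_sum0.
rewrite {}ev {v'} in hq *.
have [/prefixP[g pg]|n1] := boolP (prefix q p1).
  rewrite {}pg {p1} in hp1 *.
  rewrite (epath_cat _ _ hq) in hp1.
  rewrite (gel_pel_cat hq hp1) lpa_mulA -(pel_cat hp hp1) -[_ ** _]scale1r.
  by apply: monomial_sumM hq1; rewrite (epath_cat _ _ hp).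
have [/prefixP[g pg]|n2] := boolP (prefix p1 q).
  rewrite {}pg {q n1} in hq *.
  rewrite (epath_cat _ _ hp1) in hq.
  rewrite (gel_cat_pel hp1 hq) -(gel_cat hq1 hq) -[_ ** _]scale1r.
  by apply: monomial_sumM hp _; rewrite (epath_cat _ _ hq1).
rewrite (gel_pel_incomparable hq hp1 n1 n2) lpa_mul0l lpa_mul0r.
exact: monomial_sum0.
Qed.

Lemma monomial_sumT x : monomial_sum x.
Proof.
elim/lpaW: x; elim=> [v|e|e||x hx y hy|x hx|x hx y hy|s x hx]; rewrite ?lpa_classE.
- have := @monomial_sumM 1 v [::] v [::] v; rewrite /= scale1r mul_vv.
  by apply.
- have := @monomial_sumM 1 (src e) [:: e] (rng e) [::] (rng e).
  by rewrite /= scale1r !mul_edge_rng !eqxx; apply.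
- have := @monomial_sumM 1 (rng e) [::] (src e) [:: e] (rng e).
  by rewrite /= scale1r !mul_rng_ghost !eqxx; apply.
- exact: monomial_sum0.
- exact: monomial_sumD.
- have -> : lpa_opp (lpa_class x) = -1 *: lpa_class x by rewrite scaleN1r.
  exact: monomial_sumZ.
- exact: monomial_sum_mul.
- exact: monomial_sumZ.
Qed.

End PathElements.

(** * A graded representation on functions on boundary paths *)

Section PathSpaceRepresentation.
Context (R : comPzRingType) (E : digraph).

Definition point : Type := nat -> vertex E * option (edge E).
Implicit Types (z : point) (F : point * int -> R) (t : lpa_term R E).

(* A point records the vertices and edges of a boundary path; after a missing
   edge, which is allowed only at a vertex that is not regular, its values are
   irrelevant. *)
Definition boundary_path z : Prop := forall k,
  if (z k).2 is Some e then src e = (z k).1 /\ (z k.+1).1 = rng e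
  else ~ regular (z k).1.

Definition shift_point z : point := fun k => z k.+1.

Definition cons_point e z : point :=
  fun k => if k is k'.+1 then z k' else (src e, Some e).

Lemma boundary_path_shift z : boundary_path z -> boundary_path (shift_point z).
Proof. by move=> hz k; exact: hz. Qed.

Lemma boundary_path_cons e z :
  boundary_path z -> (z 0%N).1 = rng e -> boundary_path (cons_point e z).
Proof. by move=> hz z0 [|k] //=; exact: hz. Qed.

Lemma boundary_path_exists (v : vertex E) : exists2 z, boundary_path z & (z 0%N).1 = v.
Proof.
have [o ho] : exists o : vertex E -> option (edge E),
    forall w, if o w is Some e then src e = w else ~ regular w.
  pose P w (o : option (edge E)) :=
    if o is Some e then src e = w else ~ regular w.
  suff /boolp.choice[o ho] : forall w, exists o, P w o by exists o.
  move=> w.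
  have [[_ [e /= he]]|nr] := pselect (regular w); first by exists (Some e).
  by exists None.
(* After a stop the sequence stays at the same vertex, so that the condition on boundary paths holds
   at all later indices too. *)
pose nxt w := if o w is Some e then rng e else w.
exists (fun k => (iter k nxt v, o (iter k nxt v))) => // k; rewrite /= /nxt -/nxt.
have := ho (iter k nxt v).
by case: (o _) => [e /=|].
Qed.

(* The second coordinate of a point of the representation is the degree. *)
Fixpoint act t F : point * int -> R := match t with
  | TVertex v => fun x => if (x.1 0%N).1 == v then F x else 0
  | TEdge e => fun x =>
      if (x.1 0%N).2 == Some e then F (shift_point x.1, x.2 - 1) else 0
  | TGhost e => fun x =>
      if (x.1 0%N).1 == rng e then F (cons_point e x.1, x.2 + 1) else 0
  | TZero => fun => 0
  | TAdd x y => fun zn => act x F zn + act y F zn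
  | TOpp x => fun zn => - act x F zn
  | TMul x y => act x (act y F)
  | TScale a x => fun zn => a * act x F zn
  end.

(** The relations of the algebra hold for [act] only at boundary paths, so functions are compared
    there alone. *)
Definition bequal F F' : Prop :=
  forall z n, boundary_path z -> F (z, n) = F' (z, n).

Lemma act_bequal t F F' : bequal F F' -> bequal (act t F) (act t F').
Proof.
elim: t F F' => [v|e|e||x hx y hy|x hx|x hx y hy|a x hx] F F' FF' z n hz //=.
- by rewrite FF'.
- by rewrite FF' //; exact: boundary_path_shift.
- by case: eqP => // ze; rewrite FF' //; exact: boundary_path_cons.
- by rewrite (hx _ _ FF') // (hy _ _ FF').
- by rewrite (hx _ _ FF').
- by apply: hx => //; exact: hy.
- by rewrite (hx _ _ FF').
Qed.

Lemma actD t F F' : act t (fun zn => F zn + F' zn) = (fun zn => act t F zn + act t F' zn).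
Proof.
elim: t F F' => [v|e|e||x hx y hy|x hx|x hx y hy|a x hx] F F'; apply/funext=> z /=;
  rewrite ?addr0 //; try by case: ifP; rewrite ?addr0.
- by rewrite hx hy addrACA.
- by rewrite hx opprD.
- by rewrite hy hx.
- by rewrite hx mulrDr.
Qed.

Lemma actZ t a F : act t (fun zn => a * F zn) = (fun zn => a * act t F zn).
Proof.
elim: t F => [v|e|e||x hx y hy|x hx|x hx y hy|b x hx] F; apply/funext=> z /=;
  rewrite ?mulr0 //; try by case: ifP; rewrite ?mulr0.
- by rewrite hx hy mulrDr.
- by rewrite hx mulrN.
- by rewrite hy hx.
- by rewrite hx mulrCA.
Qed.

Lemma cons_shift_point z e :
  (z 0%N) = (src e, Some e) -> cons_point e (shift_point z) = z.
Proof. by move=> z0; apply/funext => -[|k] /=. Qed.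

(** A boundary path from a regular vertex has a first edge; the summand e e^* of that edge gives
    back [F], and the other summands vanish. *)
Lemma act_regular u (s : seq (edge E)) F z n :
  s != [::] -> uniq s -> (forall e, (e \in s) = (src e == u)) ->
  boundary_path z ->
  (if (z 0%N).1 == u then F (z, n) else 0) =
  act (foldr (fun e => TAdd (TMul (TEdge R e) (TGhost R e))) (TZero R E) s) F (z, n).
Proof.
move=> s0 us sP hz.
transitivity (if (z 0%N).2 is Some e then if e \in s then F (z, n) else 0 else 0).
  have := hz 0%N; case: (z 0%N) => v [e|] /=.
    by case=> <- _; rewrite sP.
  case: eqP => // -> []; split.
    rewrite (_ : emitted u = [set` s]); first exact: finite_seq.
    by rewrite predeqE => e; rewrite /= sP; split=> /eqP.
  by case: s s0 {us} sP => // e s _ /(_ e); rewrite mem_head => /esym/eqP; exists e.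
have hz0 := hz 0%N.
elim: s us {s0 sP} => [|e s IH] /=; first by case: (z 0%N).2.
case/andP=> es us; rewrite -(IH us).
case z2: (z 0%N).2 hz0 => [f|] /=; last by rewrite addr0.
case=> z1 z10; rewrite in_cons.
have [fe|fe] /= := eqVneq f e.
  rewrite -fe eqxx (_ : f \in s = false) ?addr0; last by rewrite fe; apply/negbTE.
  rewrite /shift_point z10 eqxx subrK cons_shift_point //.
  by move: z1 z2; case: (z 0%N) => a b /= -> ->.
rewrite (_ : (Some f == Some e) = false) ?add0r //.
by apply/negbTE; apply: contra fe => /eqP[->].
Qed.

Lemma act_cong t t' F : lpa_cong t t' -> bequal (act t F) (act t' F).
Proof.
move=> tt'; elim: tt' F => //=.
- by move=> x y _ h F z n hz; rewrite h.
- by move=> y x z _ h _ h' F w n hw; rewrite h // h'.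
- by move=> x x' y y' _ h _ h' F z n hz; rewrite h // h'.
- by move=> x x' _ h F z n hz; rewrite h.
- move=> x x' y y' _ h _ h' F z n hz; rewrite -h //.
  by apply: act_bequal.
- by move=> a x x' _ h F z n hz; rewrite h.
- by move=> x y z F w n _; rewrite addrA.
- by move=> x y F w n _; rewrite addrC.
- by move=> x F w n _; rewrite add0r.
- by move=> x F w n _; rewrite addNr.
- by move=> a b x F w n _; rewrite mulrA.
- by move=> x F w n _; rewrite mul1r.
- by move=> a x y F w n _; rewrite mulrDr.
- by move=> a b x F w n _; rewrite mulrDl.
- by move=> x y z F w n _; rewrite actD.
- by move=> a x y F w n _; rewrite actZ.
- by move=> v F z n hz /=; case: ((z 0%N).1 == v).
- move=> v w vw F z n hz /=; case: eqP => // ->.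
  by rewrite (negPf vw).
- move=> e F z n hz /=; case: (eqVneq _ (Some e)) => [ze|//].
    by have := hz 0%N; rewrite ze => -[-> _]; rewrite eqxx.
  by rewrite if_same.
- move=> e F z n hz /=; case: (eqVneq _ (Some e)) => [ze|//].
  by have := hz 0%N; rewrite ze => -[_]; rewrite /shift_point => ->; rewrite eqxx.
- by move=> e F z n hz /=; case: ((z 0%N).1 == rng e).
- by move=> e F z n hz /=; rewrite eqxx.
- move=> e F z n hz /=; rewrite eqxx addrK.
  by rewrite (_ : shift_point (cons_point e z) = z).
- move=> e f ef F z n hz /=; rewrite (_ : (Some e == Some f) = false) ?if_same //.
  by apply/negbTE; apply: contra ef => /eqP[->].
- by move=> u s s0 us sP F z n hz; exact: act_regular.
Qed.

Definition supported (d : int) F : Prop :=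
  forall z n, boundary_path z -> n != d -> F (z, n) = 0.

Definition lpa_act (x : lpa R E) F := act (lpa_repr x) F.

Lemma lpa_act_class t F : bequal (lpa_act (lpa_class t) F) (act t F).
Proof. exact/act_cong/lpa_repr_class. Qed.

Lemma lpa_act_mul x y F : bequal (lpa_act (x ** y) F) (lpa_act x (lpa_act y F)).
Proof. exact: lpa_act_class. Qed.

(** An edge raises the degree by one; dually, a ghost edge lowers it by one. *)
Lemma lpa_act_pel v p d F : supported d F ->
  supported (d + (size p)%:Z) (lpa_act (pel R v p) F).
Proof.
move=> hF; elim: p v => [|e p IH] v z n hz /= nd; rewrite ?lpa_act_mul ?lpa_act_class //=.
  by case: ifP => // _; rewrite hF // -[d]addr0.
case: ifP => // _; apply: IH; first exact: boundary_path_shift.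
by apply: contra nd => /eqP h; apply/eqP; lia.
Qed.

Lemma lpa_act_gel v p d F : supported d F ->
  supported (d - (size p)%:Z) (lpa_act (gel R v p) F).
Proof.
elim: p v d F => [|e p IH] v d F hF z n hz /= nd.
  rewrite ?lpa_act_class //=.
  by case: ifP => // _; rewrite hF // -[d]subr0.
rewrite ?lpa_act_mul //; apply: (IH _ (d - 1)) => //; last first.
  by apply: contra nd => /eqP h; apply/eqP; lia.
move=> {n nd hz}z n hz nd; rewrite lpa_act_class //=.
case: eqP => // ze; apply: hF; first exact: boundary_path_cons.
by apply: contra nd => /eqP h; apply/eqP; lia.
Qed.

(** Let elements act on the function that is 1 in degree 0 and 0 elsewhere, and evaluate in degree 0
    at a boundary path from [u]. Paths and ghost paths of positive length move the degree away from
    0. *)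
Lemma coefficient_functional (u : vertex E) : exists tr : lpa R E -> R,
  [/\ forall a x y, tr (a *: x + y) = a * tr x + tr y,
      tr (lpa_vertex R u) = 1,
      forall v p, p != [::] -> tr (pel R v p) = 0
    & forall v p, p != [::] -> tr (gel R v p) = 0].
Proof.
have [z hz z0] := boundary_path_exists u.
pose F0 : point * int -> R := fun x => if x.2 == 0 then 1 else 0.
have hF0 : supported 0 F0 by move=> y n _ /negPf n0; rewrite /F0 /= n0.
exists (fun x => lpa_act x F0 (z, 0)); split.
- move=> a; elim/lpaW=> x; elim/lpaW=> y.
  have -> : a *: lpa_class x + lpa_class y = lpa_class (TAdd (TScale a x) y).
    by rewrite lpa_class_add lpa_class_scale.
  by rewrite !lpa_act_class.
- by rewrite lpa_act_class //= z0 eqxx.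
- move=> v p p0; have h : supported _ _ := @lpa_act_pel v p _ _ hF0.
  apply: h => //.
  by case: p p0.
- move=> v p p0; have h : supported _ _ := @lpa_act_gel v p _ _ hF0.
  apply: h => //.
  by case: p p0.
Qed.

Lemma vertex_torsion_free (u : vertex E) (a b : R) :
  a *: lpa_vertex R u = b *: lpa_vertex R u -> a = b.
Proof.
have [tr [trL tru _ _]] := coefficient_functional u.
have tr0 : tr 0 = 0.
  have := trL 1 0 0; rewrite scale1r addr0 mul1r => h.
  by apply: (@addrI _ (tr 0)); rewrite -h addr0.
move=> /(congr1 (fun x => tr (x + 0))); rewrite !trL tr0 tru !addr0 !mulr1.
by [].
Qed.

End PathSpaceRepresentation.

(** * Products of ideals as finite sums *)

Section IdealProducts.
Context (A : zmodType) (op : A -> A -> A).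
Implicit Types (I J : set A).

Lemma ideal_mul0 I J : ideal_mul op I J 0.
Proof.
exists 0%N, (fun=> 0), (fun=> 0); split; try by case.
by rewrite big_ord0.
Qed.

Lemma ideal_mul_gen I J x y : I x -> J y -> ideal_mul op I J (op x y).
Proof. by move=> Ix Jy; exists 1%N, (fun=> x), (fun=> y); rewrite big_ord1. Qed.

Lemma ideal_mulD I J x y :
  ideal_mul op I J x -> ideal_mul op I J y -> ideal_mul op I J (x + y).
Proof.
move=> [n [a [b [Ia Jb ->]]]] [m [a' [b' [Ia' Jb' ->]]]].
exists (n + m)%N, (fun i => match fintype.split i with inl j => a j | inr j => a' j end),
  (fun i => match fintype.split i with inl j => b j | inr j => b' j end).
split; [by move=> i; case: fintype.split..|].
rewrite big_split_ord /=; congr (_ + _); apply: eq_bigr => i _.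
  by rewrite -[lshift m i]/(unsplit (inl i)) unsplitK.
by rewrite -[rshift n i]/(unsplit (inr i)) unsplitK.
Qed.

Lemma ideal_mul_sum I J T (s : seq T) (F : T -> A) :
  (forall i, ideal_mul op I J (F i)) -> ideal_mul op I J (\sum_(i <- s) F i).
Proof.
move=> h; apply: (big_ind (ideal_mul op I J)) => //; first exact: ideal_mul0.
exact: ideal_mulD.
Qed.

Lemma ideal_mul_ind I J (P : A -> Prop) :
  P 0 -> (forall x y, P x -> P y -> P (x + y)) ->
  (forall x y, I x -> J y -> P (op x y)) -> forall z, ideal_mul op I J z -> P z.
Proof. by move=> P0 PD Pop z [n [a [b [Ia Jb ->]]]]; apply: big_ind => // i _; exact: Pop. Qed.

Lemma ideal_mul_sub I J I' J' : I `<=` I' -> J `<=` J' ->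
  ideal_mul op I J `<=` ideal_mul op I' J'.
Proof.
move=> II' JJ'; apply: ideal_mul_ind; [exact: ideal_mul0|exact: ideal_mulD|].
by move=> x y /II' Ix /JJ' Jy; exact: ideal_mul_gen.
Qed.

Lemma ideal_closedD I x y : ideal op I -> I x -> I y -> I (x + y).
Proof.
move=> [I0 IB _] Ix Iy; rewrite -[y]opprK; apply: (IB) => //.
by rewrite -sub0r; exact: IB.
Qed.

Lemma ideal_closed_sum I T (s : seq T) (F : T -> A) : ideal op I ->
  (forall i, I (F i)) -> I (\sum_(i <- s) F i).
Proof.
move=> idI h; apply: (big_ind I) => //; first by case: idI.
by move=> x y; exact: ideal_closedD.
Qed.

End IdealProducts.

(** * Evaluation of Laurent polynomials at a closed path *)

Section LaurentEvaluation.
Context (R : comPzRingType) (E : digraph).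
Implicit Types (u v w : vertex E) (c p q : seq (edge E)) (m n : int).

Definition cyc c k : seq (edge E) := flatten (nseq k c).

Lemma cycD c j k : cyc c (j + k) = cyc c j ++ cyc c k.
Proof. by rewrite /cyc nseqD flatten_cat. Qed.

Lemma cyc1 c : cyc c 1 = c.
Proof. exact: cats0. Qed.

Lemma size_cyc c k : size (cyc c k) = (k * size c)%N.
Proof. by elim: k => // k IH; rewrite /cyc /= size_cat IH mulSn. Qed.

Lemma epath_cyc u c k : epath u c u -> epath u (cyc c k) u.
Proof. by move=> hc; elim: k => [|k IH] /=; rewrite ?(epath_cat _ _ hc). Qed.

(** Link between paths with given ends and the sequences [e :: p] used for closed paths and
    cycles. *)
Lemma epath_composable v e p w :
  epath v (e :: p) w = (src e == v) && path (@composable E) e p && (rng (last e p) == w).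
Proof.
rewrite /= -andbA; congr (_ && _); elim: p e => [|f p IH] e //=.
by rewrite IH /composable (eq_sym (rng e)) andbA.
Qed.

Lemma closed_pathP u c :
  (closed_path c && based_at u c) = (c != [::]) && epath u c u.
Proof.
case: c => [|e p] //; rewrite epath_composable /=.
by case: (eqVneq (src e) u) => [->|_]; rewrite ?andbT ?andbF.
Qed.

Lemma lpa_prod_rcons (s : seq (lpa R E)) x :
  s != [::] -> lpa_prod (rcons s x) = lpa_prod s ** x.
Proof. by case: s => // y s _; rewrite /= foldl_rcons. Qed.

Lemma lpa_path_ghostE u e p w : epath u (e :: p) w ->
  lpa_path_ghost R (e :: p) = gel R u (e :: p).
Proof.
elim: p u e => [|f p IH] u e /=.
  by move=> _; rewrite mul_rng_ghost.
case/andP=> _ h; rewrite /lpa_path_ghost map_cons rev_cons lpa_prod_rcons.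
  by have := IH _ _ h; rewrite /lpa_path_ghost => ->.
by rewrite -size_eq0 size_rev.
Qed.

Lemma lpa_pathE u c : c != [::] -> epath u c u -> lpa_path R c = pel R u c.
Proof.
case: c => // e p _ /andP[_ h]; rewrite /lpa_path /=.
have := mul_edge_rng R e; move: (lpa_edge R e) (rng e) h => x v.
elim: p v x => [|f p IH] v x /=; first by move=> _ ->.
case/andP=> /eqP <- h hx.
by rewrite (IH _ _ h) -lpa_mulA ?mul_edge_rng // lpa_mulA.
Qed.

(** [lpa_prod] folds from its first factor; for the induction that factor is generalized to any x
    with x u = x. *)
Lemma foldl_pel_cyc u c k (x : lpa R E) : epath u c u -> x ** lpa_vertex R u = x ->
  foldl (@lpa_mul R E) x (nseq k (pel R u c)) = x ** pel R u (cyc c k).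
Proof.
move=> hc; elim: k x => [|k IH] x hx //=.
rewrite IH -?lpa_mulA ?(mul_pel_v R hc) //.
by rewrite -(pel_cat R hc (epath_cyc k hc)).
Qed.

Lemma foldl_gel_cyc u c k (x : lpa R E) : epath u c u -> x ** lpa_vertex R u = x ->
  foldl (@lpa_mul R E) x (nseq k (gel R u c)) = x ** gel R u (cyc c k).
Proof.
move=> hc; elim: k x => [|k IH] x hx //=.
rewrite IH -?lpa_mulA ?(mul_gel_v R hc) //.
by rewrite -(gel_cat R (epath_cyc k hc) hc) -{2}[c]cyc1 -cycD addn1.
Qed.

Lemma lcoef0 n : lcoef (0 : laurent R) n = 0.
Proof. exact: monalg.mcoeff0. Qed.

Lemma lcoef_sum T (s : seq T) (F : T -> laurent R) n :
  lcoef (\sum_(i <- s) F i) n = \sum_(i <- s) lcoef (F i) n.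
Proof.
exact: (big_morph (fun P => lcoef P n) (fun P Q => lcoefD P Q n) (lcoef0 n)).
Qed.

Section Cycle.
Variables (u : vertex E) (c : seq (edge E)).
Hypotheses (c0 : c != [::]) (hc : epath u c u).

Lemma lpa_cycle_powP k : lpa_cycle_pow R c k%:Z = pel R u (cyc c k).
Proof.
case: k => [|k].
  by case: c c0 hc => // e p _ /andP[/eqP <-].
rewrite /= (lpa_pathE c0 hc) foldl_pel_cyc ?(mul_pel_v R hc) //.
by rewrite -(pel_cat R hc (epath_cyc k hc)).
Qed.

Lemma lpa_cycle_powN k : lpa_cycle_pow R c (- k%:Z) = gel R u (cyc c k).
Proof.
case: k => [|k]; first exact: (lpa_cycle_powP 0).
rewrite -NegzE /=.
have -> : lpa_path_ghost R c = gel R u c by case: c c0 hc => // e p _; exact: lpa_path_ghostE.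
rewrite foldl_gel_cyc ?(mul_gel_v R hc) //.
by rewrite -(gel_cat R (epath_cyc k hc) hc) -{2}[c]cyc1 -cycD addn1.
Qed.

Let vk k := epath_cyc k hc.

Lemma gel_pel_cyc j k :
  gel R u (cyc c j) ** pel R u (cyc c k) = lpa_cycle_pow R c (k%:Z - j%:Z).
Proof.
have [jk|/ltnW kj] := leqP j k.
  have -> : k%:Z - j%:Z = (k - j)%N%:Z by lia.
  by rewrite -{1}(subnKC jk) cycD (gel_pel_cat R (vk _) (vk _)) lpa_cycle_powP.
have -> : k%:Z - j%:Z = - (j - k)%N%:Z by lia.
by rewrite -{1}(subnKC kj) cycD (gel_cat_pel R (vk _) (vk _)) lpa_cycle_powN.
Qed.

(** The right exponent is nonnegative because c^* c = u always holds, whereas c c^* = u fails in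
    general. *)
Lemma lpa_cycle_powDr m (k : nat) :
  lpa_cycle_pow R c (m + k%:Z) = lpa_cycle_pow R c m ** lpa_cycle_pow R c k%:Z.
Proof.
have [j [->|->]] : exists j : nat, m = j%:Z \/ m = - j%:Z.
  by exists `|m|%N; lia.
  by rewrite !lpa_cycle_powP -(pel_cat R (vk _) (vk _)) -cycD -lpa_cycle_powP.
by rewrite lpa_cycle_powP lpa_cycle_powN gel_pel_cyc addrC.
Qed.

Lemma lpa_cycle_powDl (k : nat) m :
  lpa_cycle_pow R c (- k%:Z + m) = lpa_cycle_pow R c (- k%:Z) ** lpa_cycle_pow R c m.
Proof.
have [j [->|->]] : exists j : nat, m = j%:Z \/ m = - j%:Z.
  by exists `|m|%N; lia.
  by rewrite lpa_cycle_powP lpa_cycle_powN gel_pel_cyc addrC.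
rewrite !lpa_cycle_powN -(gel_cat R (vk _) (vk _)) -cycD -lpa_cycle_powN.
by congr lpa_cycle_pow; lia.
Qed.

Local Notation ev P := (lpa_eval P c).
Implicit Types (P Q : laurent R).

Lemma lpa_eval_sub (d : {fset int}) P : (lsupp P `<=` d)%fset ->
  ev P = \sum_(n <- d) lcoef P n *: lpa_cycle_pow R c n.
Proof.
move=> le; rewrite /lpa_eval (big_fset_incl _ le) //= => n _ /lcoef_out ->.
by rewrite scale0r.
Qed.

Lemma lpa_evalD P Q : ev (P + Q) = ev P + ev Q.
Proof.
set d := (lsupp P `|` lsupp Q)%fset.
rewrite (@lpa_eval_sub d P) ?fsubsetUl // (@lpa_eval_sub d Q) ?fsubsetUr //.
rewrite (@lpa_eval_sub d (P + Q)%R); last exact: monalg.msuppD_le.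
by rewrite -big_split; apply: eq_bigr => n _; rewrite lcoefD scalerDl.
Qed.

Lemma lpa_eval0 : ev 0 = 0 :> lpa R E.
Proof. by apply: (@addrI _ (ev 0)); rewrite -lpa_evalD !addr0. Qed.

Lemma lpa_eval_sum T (s : seq T) (F : T -> laurent R) :
  ev (\sum_(i <- s) F i) = \sum_(i <- s) ev (F i).
Proof. exact: (big_morph (fun P => ev P) lpa_evalD lpa_eval0). Qed.

Lemma lpa_eval_lmono a n : ev (lmono a n) = a *: lpa_cycle_pow R c n.
Proof.
rewrite (@lpa_eval_sub [fset n]%fset); last exact: monalg.msuppU_le.
by rewrite big_seq_fset1 /lcoef monalg.mcoeffUU.
Qed.

Lemma lpa_eval_lconst a : ev (lconst a) = a *: lpa_vertex R u.
Proof. by rewrite lpa_eval_lmono (lpa_cycle_powP 0). Qed.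

(** Evaluation is not multiplicative in general, again because of c c^* ; the sign condition avoids
    a negative power to the right of a positive one. *)
Lemma lpa_evalMr P Q : {in lsupp Q, forall n, (0 <= n)%R} -> ev (P * Q) = ev P ** ev Q.
Proof.
move=> hQ; rewrite [P]laurentE mulr_suml !lpa_eval_sum lpa_suml.
apply: eq_bigr => m _; rewrite [Q]laurentE mulr_sumr !lpa_eval_sum lpa_sumr.
rewrite !big_seq; apply: eq_bigr => n /hQ n0.
rewrite [X in lpa_eval X c]laurent_mulUU !lpa_eval_lmono lpa_scaleAl lpa_scaleAr scalerA.
by case: n n0 => // k _; rewrite lpa_cycle_powDr.
Qed.

Lemma lpa_evalMl P Q : {in lsupp P, forall n, (n <= 0)%R} -> ev (P * Q) = ev P ** ev Q.
Proof.
move=> hP; rewrite [P]laurentE mulr_suml !lpa_eval_sum lpa_suml.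
rewrite !big_seq; apply: eq_bigr => m /hP m0.
rewrite [Q]laurentE mulr_sumr !lpa_eval_sum lpa_sumr; apply: eq_bigr => n _.
rewrite [X in lpa_eval X c]laurent_mulUU !lpa_eval_lmono lpa_scaleAl lpa_scaleAr scalerA.
have -> : m = - `|m|%N%:Z by lia.
by rewrite lpa_cycle_powDl.
Qed.

(** Multiplication by c^(-n), on the left for n >= 0 and on the right for n <= 0, moves the n-th
    term to degree zero, where the functional of the base vertex reads it off. *)
Lemma lpa_eval_coefficient n : exists cf : lpa R E -> R,
  forall P, cf (ev P) = lcoef P n.
Proof.
have [tr [trL tru trp trg]] := coefficient_functional R u.
have [cf cfL cfm] : exists2 cf : lpa R E -> R,
    forall a x y, cf (a *: x + y) = a * cf x + cf y &
    forall m, cf (lpa_cycle_pow R c m) = (m == n)%:R.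
  have trpow m : tr (lpa_cycle_pow R c m) = (m == 0)%:R.
    have [j [->|->]] : exists j : nat, m = j%:Z \/ m = - j%:Z.
      by exists `|m|%N; lia.
      case: j => [|j]; first by rewrite (lpa_cycle_powP 0) tru.
      rewrite lpa_cycle_powP trp //.
      by rewrite -size_eq0 size_cyc muln_eq0 size_eq0 (negPf c0).
    case: j => [|j]; first by rewrite (lpa_cycle_powP 0) tru.
    rewrite lpa_cycle_powN trg //.
    by rewrite -size_eq0 size_cyc muln_eq0 size_eq0 (negPf c0).
  have [k [nk|nk]] : exists k : nat, n = k%:Z \/ n = - k%:Z.
    by exists `|n|%N; lia.
    exists (fun x => tr (lpa_cycle_pow R c (- k%:Z) ** x)).
      by move=> a x y; rewrite lpa_mulDr lpa_scaleAr trL.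
    by move=> m; rewrite -lpa_cycle_powDl trpow nk addrC subr_eq0.
  exists (fun x => tr (x ** lpa_cycle_pow R c k%:Z)).
    by move=> a x y; rewrite lpa_mulDl lpa_scaleAl trL.
  by move=> m; rewrite -lpa_cycle_powDr trpow nk addr_eq0.
exists cf => P.
have cf0 : cf 0 = 0.
  have := cfL 1 0 0; rewrite scale1r addr0 mul1r => h.
  by apply: (@addrI _ (cf 0)); rewrite -h addr0.
have cfD x y : cf (x + y) = cf x + cf y by rewrite -[x]scale1r cfL mul1r scale1r.
rewrite /lpa_eval (big_morph cf cfD cf0).
transitivity (\sum_(m <- lsupp P) lcoef P m * (m == n)%:R).
  by apply: eq_bigr => m _; rewrite -[_ *: _]addr0 cfL cf0 cfm addr0.
have [nP|nP] := boolP (n \in lsupp P).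
  rewrite (bigD1_seq n) //= ?eqxx ?mulr1 ?big1 ?addr0 //.
    by move=> m /negPf ->; rewrite mulr0.
  exact: fset_uniq.
rewrite (lcoef_out nP) big_seq big1 // => m mP.
by case: eqP => [mn|]; rewrite ?mulr0 //; rewrite -mn mP in nP.
Qed.

Lemma lpa_eval_inj P Q : ev P = ev Q -> P = Q.
Proof.
move=> PQ; apply/monalg.malgP => n.
have [cf cfE] := lpa_eval_coefficient n.
by have := congr1 cf PQ; rewrite !cfE.
Qed.

(** Q is treated one monomial at a time: nonnegative powers of c multiply on the right, negative
    ones on the left. *)
Lemma pair_gM I P Q : ideal (@lpa_mul R E) I -> pair_g I c P -> pair_g I c (P * Q).
Proof.
move=> idI IP; rewrite /pair_g /= [Q]laurentE mulr_sumr lpa_eval_sum.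
apply: (ideal_closed_sum _ idI) => n.
have supp1 (a : R) : {in lsupp (lmono a n), forall m, m = n}.
  move=> m hm; have /fsubsetP/(_ m hm) : (lsupp (lmono a n) `<=` [fset n])%fset.
    exact: monalg.msuppU_le.
  by rewrite inE => /eqP.
case: idI => _ _ idM; have [n0|n0] := Order.TotalTheory.leP 0 n.
  rewrite lpa_evalMr; last by move=> m /supp1 ->.
  by case: (idM (ev (lmono (lcoef Q n) n)) _ IP).
rewrite mulrC lpa_evalMl; last by move=> m /supp1 ->; exact: Order.POrderTheory.ltW.
by case: (idM (ev (lmono (lcoef Q n) n)) _ IP).
Qed.

Lemma pair_g_ideal_mul I J : ideal (@lpa_mul R E) I -> ideal (@lpa_mul R E) J ->
  ideal_mul *%R (pair_g I c) (pair_g J c) `<=` pair_g (ideal_mul (@lpa_mul R E) I J) c.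
Proof.
move=> idI idJ; apply: ideal_mul_ind.
- by rewrite /pair_g /= lpa_eval0; exact: ideal_mul0.
- by move=> P Q; rewrite /pair_g /= lpa_evalD; exact: ideal_mulD.
move=> P Q IP JQ.
(* N bounds the exponents of Q in absolute value. Shifting P by x^(-N) and Q by x^N keeps the
   product and removes the negative exponents of the second factor, so that evaluation becomes
   multiplicative. *)
pose N := \sum_(n <- lsupp Q) `|n|%N.
have -> : P * Q = (P * lmono 1 (- N%:Z)) * (Q * lmono 1 N%:Z).
  rewrite mulrACA [X in _ = _ * X](laurent_mulUU 1 1) mulr1 addNr.
  by rewrite [X in _ = _ * X](_ : _ = 1) // mulr1.
rewrite /pair_g /= lpa_evalMr; last first.
  move=> n; apply: contraTT => n0; rewrite -monalg.mcoeff_eq0 -[X in X == 0]/(lcoef _ n).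
  rewrite {1}[Q]laurentE mulr_suml lcoef_sum big_seq big1 //= => m mQ.
  rewrite [X in lcoef X _](laurent_mulUU (lcoef Q m) 1) /lcoef monalg.mcoeffU.
  case: eqP => // mn; case/negP: n0; rewrite -mn.
  have : (`|m| <= N)%N by rewrite /N (bigD1_seq m) //= ?leq_addr ?fset_uniq.
  by lia.
by apply: ideal_mul_gen; exact: pair_gM.
Qed.

End Cycle.

End LaurentEvaluation.

(** * The complete lattice of admissible pairs *)

Section AdmissiblePairs.
Context (E : digraph).
Implicit Types (P Q U : admissible E) (X : set (admissible E)) (H : set (vertex E)).

Lemma hereditary_edge H : hereditary H <-> forall e, H (src e) -> H (rng e).
Proof.
split=> [hH e|hH e p]; first exact: (hH e [::]).
elim: p e => [|f p IH] e /=; first by move=> _; exact: hH.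
by case/andP=> /eqP ef hp /hH; rewrite ef; exact: IH.
Qed.

Lemma admissible_le_refl P : admissible_le P P.
Proof. by split=> // v; right. Qed.

Lemma admissible_le_trans Q P U :
  admissible_le P Q -> admissible_le Q U -> admissible_le P U.
Proof.
move=> [PQ PQS] [QU QUS]; split=> v; first by move=> /PQ /QU.
by move=> /PQS[/QU|/QUS] //; left.
Qed.

Definition bigcap_adH X : set (vertex E) := \bigcap_(U in X) adH U.

Lemma bigcap_adH_hereditary X : hereditary (bigcap_adH X).
Proof. by move=> e p hp hv U XU; apply: (adH_hereditary hp); exact: hv. Qed.

Lemma bigcap_adH_saturated X : saturated (bigcap_adH X).
Proof.
by move=> v rv hv U XU; apply: (adH_saturated rv) => e /hv; exact.
Qed.

(** The infimum of a family. A vertex may lie in the first component of one member and in the second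
    of another, so breaking is required anew for the intersection. The empty family gives the top
    pair. *)
Program Definition adm_meet X := @Admissible E (bigcap_adH X)
  [set w | breaking (bigcap_adH X) w /\ forall U, X U -> (adH U `|` adS U) w]
  (@bigcap_adH_hereditary X) (@bigcap_adH_saturated X) _.
Next Obligation. by move=> X w []. Qed.

Lemma adm_meet_le X U : X U -> admissible_le (adm_meet X) U.
Proof. by move=> XU; split=> v; [apply|case=> _; exact]. Qed.

(* A vertex outside some [adH U] breaks [adH U], so it emits an edge to the
   complement of [adH U], hence to that of the intersection. *)
Lemma mem_adm_meet X w :
  (forall U, X U -> (adH U `|` adS U) w) ->
  finite_set (emitted_outside (bigcap_adH X) w) ->
  (adH (adm_meet X) `|` adS (adm_meet X)) w.
Proof.
move=> wX fin; have [|nw] := pselect (bigcap_adH X w); first by left.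
right; split=> //.
have [U XU nU] : exists2 U, X U & ~ adH U w.
  apply: contrapT => h; apply: nw => U XU; apply: contrapT => nU.
  by apply: h; exists U.
have [//|/adS_breaking[inf _ [e [we ne]] _]] := wX _ XU.
by split=> //; exists e; split=> // /(_ _ XU).
Qed.

(** Edges leaving the intersection also leave the smaller set [adH Q], so their finiteness is
    inherited from Q. *)
Lemma le_adm_meet X Q : (forall U, X U -> admissible_le Q U) ->
  admissible_le Q (adm_meet X).
Proof.
move=> QX.
have QH : adH Q `<=` bigcap_adH X by move=> v Qv U /QX[QU _]; exact: QU.
split=> // w Qw; apply: mem_adm_meet; first by move=> U /QX[_]; exact.
have [_ _ _] := adS_breaking Qw; apply: sub_finite_set => e [we ne].
by split=> // /QH.
Qed.

(** The meet of all upper bounds is the join. *)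
Lemma is_join_exists X : exists P, is_join X P.
Proof.
exists (adm_meet [set U | forall Q, X Q -> admissible_le Q U]); split.
  by move=> Q XQ; apply: le_adm_meet => U; exact.
by move=> U hU; exact: adm_meet_le.
Qed.

Lemma set0_hereditary : hereditary (set0 : set (vertex E)).
Proof. by move=> e p _. Qed.

Lemma set0_saturated : saturated (set0 : set (vertex E)).
Proof. by move=> v [_ [e ve]] /(_ e ve). Qed.

Lemma set0_breaking H : set0 `<=` breaking H.
Proof. by []. Qed.

Definition adm_bottom := Admissible set0_hereditary set0_saturated (@set0_breaking _).

Lemma closure_hereditary (K : set (vertex E)) : hereditary (hersat_closure K).
Proof.
by move=> e p hp hv H [[hH sH] KH]; apply: (hH _ _ hp); exact: hv.
Qed.

Lemma closure_saturated (K : set (vertex E)) : saturated (hersat_closure K).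
Proof.
by move=> v rv hv H [[hH sH] KH]; apply: (sH _ rv) => e /hv; exact.
Qed.

Lemma sub_closure (K : set (vertex E)) : K `<=` hersat_closure K.
Proof. by move=> v Kv H [_]; exact. Qed.

Lemma closure_sub (K : set (vertex E)) U : K `<=` adH U -> hersat_closure K `<=` adH U.
Proof.
by move=> KU v; apply; split=> //; split; [exact: adH_hereditary|exact: adH_saturated].
Qed.

Definition adm_closure (K : set (vertex E)) :=
  Admissible (@closure_hereditary K) (@closure_saturated K) (@set0_breaking _).

Lemma adm_closure_le (K : set (vertex E)) U : admissible_le (adm_closure K) U <-> K `<=` adH U.
Proof.
split=> [[h _] v /sub_closure/h //|KU]; split=> //=; exact: closure_sub.
Qed.

Lemma star_of U v : (adH U `|` adS U) v -> ~ (adH U = set0 /\ adS U = set0).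
Proof. by case=> hv [h1 h2]; [rewrite h1 in hv|rewrite h2 in hv]. Qed.

Lemma star_point U : ~ (adH U = set0 /\ adS U = set0) -> exists v, (adH U `|` adS U) v.
Proof.
move=> h; apply: contrapT => nv; apply: h.
by split; rewrite predeqE => v; split=> // hv; apply: nv; exists v; [left|right].
Qed.

Definition adm_star U (hU : ~ (adH U = set0 /\ adS U = set0)) : admissible_star E := exist _ U hU.

End AdmissiblePairs.

(** * Saturated functions and principal sets of pairs *)

Section PrincipalPairs.
Context (E : digraph) (R : comPzRingType).
Implicit Types (f : admissible_star E -> set R) (P : admissible_star E).

(** Q is the join of all pairs P with r in f(P). As f turns joins into intersections, r also lies in
    the value of f at Q. *)
Lemma saturated_fun_principal f : saturated_fun f ->
  forall r, exists Q, forall P, f P r <-> admissible_le (sval P) Q.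
Proof.
move=> [_ fj] r; have [[P0 fP0]|none] := pselect (exists P, f P r); last first.
  (* No pair in the domain of f lies below the bottom pair. *)
  exists (adm_bottom E) => P; split=> [fP|[leH leS]]; first by case: none; exists P.
  case: none; case: (svalP P); split.
    by rewrite predeqE => v; split=> // /leH.
  by rewrite predeqE => v; split=> // /leS[].
have [Q jQ] := is_join_exists (sval @` [set P | f P r]).
have PQ P : f P r -> admissible_le (sval P) Q by move=> fP; apply: jQ.1; exists P.
have sQ : ~ (adH Q = set0 /\ adS Q = set0).
  have [v hv] := star_point (svalP P0).
  apply: (@star_of _ _ v); have [h1 h2] := PQ _ fP0.
  by case: hv => [/h1|/h2] //; left.
exists Q => P; split; first exact: PQ.
move=> lePQ; pose Q' := adm_star sQ.
have : f Q' r by rewrite (fj [set P | f P r] Q') //; exists P0.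
(* Since P is below Q', the join of the two is Q', whence f(Q') is contained in f(P). *)
rewrite (fj [set P; Q'] Q'); last 2 first.
- by exists P; left.
- split=> [_ [P' [->|->] <-] //=|U hU]; first exact: admissible_le_refl.
  by apply: hU; exists Q' => //; right.
by apply; left.
Qed.

(** A join lies below Q iff all members of the family do. *)
Lemma principal_saturated_fun f : (forall P, ideal *%R (f P)) ->
  (forall r, exists Q, forall P, f P r <-> admissible_le (sval P) Q) ->
  saturated_fun f.
Proof.
move=> idf fQ; split=> // X P _ [ub lub]; rewrite predeqE => r.
have [Q hQ] := fQ r; split=> [/hQ PQ P' XP'|hr].
  by apply/hQ; apply: admissible_le_trans PQ; apply: ub; exists P'.
by apply/hQ; apply: lub => _ [P' XP' <-]; apply/hQ; exact: hr.
Qed.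

End PrincipalPairs.

(** * Truncated vertices and the function f_I *)

Section IdealPairs.
Context (R : comPzRingType) (E : digraph).
Implicit Types (I J : set (lpa R E)) (r s : R) (v w : vertex E) (F : seq (edge E)).
Local Notation V := (@lpa_vertex R E).
Local Notation X := (@lpa_edge R E).
Local Notation G := (@lpa_ghost R E).

(* For finite [emitted_outside H w] the element [w^H] is of this form. *)
Definition trunc w F : lpa R E := V w - \sum_(e <- F | src e == w) X e ** G e.

Lemma lpa_breakingE (H : set (vertex E)) w F : uniq F ->
  (forall e, (e \in F) && (src e == w) <-> emitted_outside H w e) ->
  lpa_breaking R H w = trunc w F.
Proof.
move=> uF hF; rewrite /lpa_breaking /trunc; congr (_ - _).
rewrite -[RHS]big_filter (_ : emitted_outside H w = [set` [seq e <- F | src e == w]]).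
  by rewrite -fsbig_seq // filter_uniq.
by rewrite predeqE => e; rewrite /= mem_filter andbC; split=> /hF.
Qed.

Lemma emitted_outside_enum (H : set (vertex E)) w : finite_set (emitted_outside H w) ->
  exists2 F, uniq F & forall e, (e \in F) && (src e == w) <-> emitted_outside H w e.
Proof.
move=> fin; exists (enum_fset (fset_set (emitted_outside H w))); first exact: fset_uniq.
move=> e; have -> : (e \in enum_fset (fset_set (emitted_outside H w))) =
  (e \in emitted_outside H w) by exact: in_fset_set.
split=> [/andP[/set_mem]//|he]; rewrite mem_set //=.
by case: he => -> _; rewrite eqxx.
Qed.

Lemma trunc_nil w : trunc w [::] = V w.
Proof. by rewrite /trunc big_nil subr0. Qed.

Lemma v_trunc w F : V w ** trunc w F = trunc w F.
Proof.
rewrite /trunc lpa_mulBr mul_vv lpa_sumr; congr (_ - _).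
by apply: eq_bigr => e /eqP <-; rewrite lpa_mulA mul_src_edge.
Qed.

Lemma trunc_v w F : trunc w F ** V w = trunc w F.
Proof.
rewrite /trunc lpa_mulBl mul_vv lpa_suml; congr (_ - _).
by apply: eq_bigr => e /eqP <-; rewrite -lpa_mulA mul_ghost_src.
Qed.

Lemma ghost_trunc w F e : uniq F -> src e = w ->
  G e ** trunc w F = if e \in F then 0 else G e.
Proof.
move=> uF ew; rewrite /trunc lpa_mulBr -{1}ew mul_ghost_src lpa_sumr.
have z f : f != e -> G e ** (X f ** G f) = 0.
  by move=> fe; rewrite lpa_mulA mul_gf 1?eq_sym // lpa_mul0l.
case: ifP => eF; last first.
  rewrite big_seq_cond big1 ?subr0 // => f /andP[fF _]; apply: z.
  by apply: contraFneq eF => <-.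
rewrite -big_filter (bigD1_seq e) ?filter_uniq ?mem_filter ?eF ?ew ?eqxx //=.
rewrite big1; last by move=> f; exact: z.
by rewrite addr0 lpa_mulA mul_ge mul_rng_ghost subrr.
Qed.

Lemma trunc_edge w F e : uniq F -> src e = w ->
  trunc w F ** X e = if e \in F then 0 else X e.
Proof.
move=> uF ew; rewrite /trunc lpa_mulBl -{1}ew mul_src_edge lpa_suml.
have z f : f != e -> (X f ** G f) ** X e = 0.
  by move=> fe; rewrite -lpa_mulA mul_gf // lpa_mul0r.
case: ifP => eF; last first.
  rewrite big_seq_cond big1 ?subr0 // => f /andP[fF _]; apply: z.
  by apply: contraFneq eF => <-.
rewrite -big_filter (bigD1_seq e) ?filter_uniq ?mem_filter ?eF ?ew ?eqxx //=.
rewrite big1; last by move=> f; exact: z.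
by rewrite addr0 -lpa_mulA mul_ge mul_edge_rng subrr.
Qed.

(** The elements [trunc w F] are idempotents that decrease as F grows: [trunc w F'] annihilates e
    e^* for each e in F' with source w. *)
Lemma trunc_truncr w F F' : uniq F' -> {subset F <= F'} ->
  trunc w F ** trunc w F' = trunc w F'.
Proof.
move=> uF' FF'; rewrite {1}/trunc lpa_mulBl v_trunc lpa_suml big_seq_cond big1 ?subr0 //.
move=> e /andP[/FF' eF' /eqP ew].
by rewrite -lpa_mulA (ghost_trunc uF' ew) eF' lpa_mul0r.
Qed.

Lemma trunc_truncl w F F' : uniq F' -> {subset F <= F'} ->
  trunc w F' ** trunc w F = trunc w F'.
Proof.
move=> uF' FF'; rewrite {2}/trunc lpa_mulBr trunc_v lpa_sumr big_seq_cond big1 ?subr0 //.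
move=> e /andP[/FF' eF' /eqP ew].
by rewrite lpa_mulA (trunc_edge uF' ew) eF' lpa_mul0l.
Qed.

Section OneIdeal.
Variables (I : set (lpa R E)) (idI : ideal (@lpa_mul R E) I).

Lemma ideal_closedMl a x : I x -> I (a ** x).
Proof. by case: idI => _ _ h /(h a)[]. Qed.

Lemma ideal_closedMr a x : I x -> I (x ** a).
Proof. by case: idI => _ _ h /(h a)[]. Qed.

Definition scalar_hereditary r : set (vertex E) := [set v | I (r *: V v)].

Lemma scalar_hereditaryP r : hereditary (scalar_hereditary r).
Proof.
apply/hereditary_edge => e; rewrite /scalar_hereditary /= => h.
have -> : r *: V (rng e) = G e ** (r *: V (src e)) ** X e.
  by rewrite lpa_scaleAr lpa_scaleAl mul_ghost_src mul_ge.
exact/ideal_closedMr/ideal_closedMl.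
Qed.

Lemma scalar_range_projection r e : I (r *: V (rng e)) -> I (r *: (X e ** G e)).
Proof.
move=> h; have -> : r *: (X e ** G e) = X e ** (r *: V (rng e)) ** G e.
  by rewrite lpa_scaleAr lpa_scaleAl mul_edge_rng.
exact/ideal_closedMr/ideal_closedMl.
Qed.

Lemma scalar_range_projections r w F :
  (forall e, e \in F -> src e = w -> I (r *: V (rng e))) ->
  I (r *: \sum_(e <- F | src e == w) X e ** G e).
Proof.
move=> hF; rewrite scaler_sumr big_seq_cond; apply: (big_ind I) => //.
- by case: idI.
- by move=> x y; exact: (ideal_closedD idI).
by move=> e /andP[eF /eqP ew]; apply: scalar_range_projection; exact: hF.
Qed.

(** A regular v is the sum of the projections e e^* , and e e^* = e r(e) e^* brings in the range of
    e. *)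
Lemma scalar_hereditary_saturated r : saturated (scalar_hereditary r).
Proof.
move=> v rv hv; rewrite /scalar_hereditary /=.
have [s [_ us sP]] := emitted_enum rv.
rewrite (lf_regular (lpa_leavitt_family R E) rv) (emitted_sum _ us sP).
have -> : \sum_(e <- s) X e ** G e = \sum_(e <- s | src e == v) X e ** G e.
  rewrite big_seq [RHS]big_seq_cond; apply: eq_bigl => e.
  by rewrite sP andbb.
by apply: scalar_range_projections => e _; exact: hv.
Qed.

Definition scalar_breaking r : set (vertex E) :=
  [set w | breaking (scalar_hereditary r) w /\
           I (r *: lpa_breaking R (scalar_hereditary r) w)].

(** By [pair_fP] this pair bounds the pairs P with r in f_I(P). It may be the empty pair, which is
    outside the domain of f_I. *)
Program Definition scalar_pair r : admissible E :=
  @Admissible E (scalar_hereditary r) (scalar_breaking r)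
    (@scalar_hereditaryP r) (@scalar_hereditary_saturated r) _.
Next Obligation. by move=> r w []. Qed.

(** Let H be [scalar_hereditary r]. Multiplying by e^* and e, for an edge e from w outside F, puts
    the range of e in H. Hence all edges from w that leave H belong to F, and w^H is [trunc w F]
    plus projections e e^* with range in H. *)
Lemma scalar_trunc_mem r w F : uniq F -> ~ regular w -> I (r *: trunc w F) ->
  (adH (scalar_pair r) `|` adS (scalar_pair r)) w /\
  forall e, src e = w -> e \notin F -> adH (scalar_pair r) (rng e).
Proof.
move=> uF nw IF.
have out e : src e = w -> e \notin F -> scalar_hereditary r (rng e).
  move=> ew eF; rewrite /scalar_hereditary /=.
  have -> : r *: V (rng e) = G e ** (r *: trunc w F) ** X e.
    by rewrite lpa_scaleAr lpa_scaleAl (ghost_trunc uF ew) (negPf eF) mul_ge.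
  exact/ideal_closedMr/ideal_closedMl.
split=> //=; have [|nH] := pselect (scalar_hereditary r w); first by left.
right; pose Fo := [seq e <- F | `[< ~ scalar_hereditary r (rng e) >]].
have FoP e : (e \in Fo) && (src e == w) <-> emitted_outside (scalar_hereditary r) w e.
  rewrite mem_filter; split=> [/andP[/andP[/asboolP ne _] /eqP ew]|[ew ne]] //.
  rewrite ew eqxx andbT (introT (asboolP _) ne) /=.
  by apply: contraT => /(out _ ew).
have uFo : uniq Fo by exact: filter_uniq.
have IFo : I (r *: trunc w Fo).
  have -> : trunc w Fo = trunc w F +
      \sum_(e <- [seq e <- F | ~~ `[< ~ scalar_hereditary r (rng e) >]] | src e == w) X e ** G e.
    rewrite /trunc -addrA; congr (_ + _); rewrite !big_filter_cond.
    rewrite [X in - X + _](bigID (fun e => `[< ~ scalar_hereditary r (rng e) >])) /= opprD.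
    rewrite -addrA [X in _ = _ + X](_ : _ = 0).
      by rewrite addr0; congr (- _); apply: eq_bigl => e; rewrite andbC.
    apply/eqP; rewrite addrC subr_eq0; apply/eqP/eq_bigl => e; exact: andbC.
  rewrite scalerDr; apply: (ideal_closedD idI) => //.
  by apply: scalar_range_projections => e; rewrite mem_filter => /andP[/asboolP/contrapT].
have IB : I (r *: lpa_breaking R (scalar_hereditary r) w).
  by rewrite (lpa_breakingE uFo FoP).
(* If no edge left H, then w^H would be w, and w would lie in H. *)
have ne0 : emitted_outside (scalar_hereditary r) w !=set0.
  apply: contrapT => e0; apply: nH; rewrite /scalar_hereditary /=.
  suff <- : trunc w Fo = V w by [].
  rewrite /trunc big_seq_cond big_pred0 ?subr0 // => e; apply/negP => /FoP he.
  by apply: e0; exists e.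
split=> //; split=> //.
  move=> fin; apply: nw; split=> //.
  by case: ne0 => e [we _]; exists e.
apply: (@sub_finite_set _ _ [set` Fo]) (finite_seq _) => e /FoP/andP[].
by [].
Qed.

Lemma pair_fP (P : admissible_star E) r :
  pair_f I P r <-> admissible_le (sval P) (scalar_pair r).
Proof.
have key w : adS (sval P) w -> exists2 F, uniq F &
    forall e, (e \in F) && (src e == w) <-> emitted_outside (adH (sval P)) w e.
  by move=> /adS_breaking[_ _ _]; exact: emitted_outside_enum.
split=> [[hH hS]|[leH leS]]; split=> //.
- move=> w Sw; have [F uF FP] := key w Sw.
  have := hS _ Sw; rewrite (lpa_breakingE uF FP) => /(scalar_trunc_mem uF)[] //.
  by case=> [fin _]; case: (adS_breaking Sw).
move=> w Sw; have [F uF FP] := key w Sw; rewrite (lpa_breakingE uF FP).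
have [Hw|nHw] := pselect (scalar_hereditary r w).
  rewrite -[trunc w F](v_trunc) -lpa_scaleAl; exact: ideal_closedMr.
have [//|[[_ _ _ fin] IB]] := leS _ Sw.
(* The first component of P is contained in that of [scalar_pair r], so fewer edges leave the
   latter. Thus Fo is contained in F, and [trunc w F] is a multiple of [trunc w Fo]. *)
pose Fo := [seq e <- F | `[< ~ scalar_hereditary r (rng e) >]].
have uFo : uniq Fo by exact: filter_uniq.
have FoP e : (e \in Fo) && (src e == w) <-> emitted_outside (scalar_hereditary r) w e.
  rewrite mem_filter; split=> [/andP[/andP[/asboolP ne _] /eqP ew]|[ew ne]] //.
  rewrite ew eqxx (introT (asboolP _) ne) /= andbT.
  by have /andP[] := (FP e).2 (conj ew (fun h => ne (leH _ h))).
rewrite (lpa_breakingE uFo FoP) in IB.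
have FoF : {subset Fo <= F} by move=> e; rewrite mem_filter => /andP[].
rewrite -(trunc_truncr w uF FoF) -lpa_scaleAl; exact: ideal_closedMr.
Qed.

Lemma pair_f_ideal (P : admissible_star E) : ideal *%R (pair_f I P).
Proof.
have [I0 IB _] := idI; split.
- by split=> v _; rewrite scale0r.
- by move=> x y [xH xS] [yH yS]; split=> v hv; rewrite scalerBl; apply: IB; auto.
have key a x y : V y ** x = x -> I x -> I (a *: x).
  by move=> yx Ix; rewrite -yx -lpa_scaleAl; exact: ideal_closedMl.
move=> a x [xH xS]; suff h : pair_f I P (a * x) by split=> //; rewrite mulrC.
split=> v hv; rewrite -scalerA.
  by apply: (key _ _ v); [rewrite lpa_scaleAr mul_vv|exact: xH].
apply: (key _ _ v); last exact: xS.
have [_ _ _ /emitted_outside_enum[F uF FP]] := adS_breaking hv.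
by rewrite (lpa_breakingE uF FP) lpa_scaleAr v_trunc.
Qed.

Lemma pair_f_saturated : saturated_fun (pair_f I).
Proof.
apply: principal_saturated_fun pair_f_ideal _ => r.
by exists (scalar_pair r) => P; exact: pair_fP.
Qed.

End OneIdeal.

Lemma ideal_mul_ideal I J : ideal (@lpa_mul R E) I -> ideal (@lpa_mul R E) J ->
  ideal (@lpa_mul R E) (ideal_mul (@lpa_mul R E) I J).
Proof.
move=> idI idJ; split; first exact: ideal_mul0.
  move=> x y hx hy; apply: ideal_mulD => //; move: y hy; apply: ideal_mul_ind.
  - by rewrite oppr0; exact: ideal_mul0.
  - by move=> a b ha hb; rewrite opprD; exact: ideal_mulD.
  move=> a b Ia Jb; rewrite -lpa_mulNl; apply: ideal_mul_gen => //.
  by rewrite -sub0r; case: idI => I0 IB _; exact: IB.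
move=> a x hx; split; move: x hx; apply: ideal_mul_ind.
- by rewrite lpa_mul0r; exact: ideal_mul0.
- by move=> y z hy hz; rewrite lpa_mulDr; exact: ideal_mulD.
- by move=> y z Iy Jz; rewrite lpa_mulA; apply: ideal_mul_gen => //; exact: ideal_closedMl.
- by rewrite lpa_mul0l; exact: ideal_mul0.
- by move=> y z hy hz; rewrite lpa_mulDl; exact: ideal_mulD.
by move=> y z Iy Jz; rewrite -lpa_mulA; apply: ideal_mul_gen => //; exact: ideal_closedMr.
Qed.

End IdealPairs.

(** * Closed paths, first returns and prefixes *)

Section PathCombinatorics.
Context (E : digraph).
Implicit Types (u v w : vertex E) (e f : edge E) (c d p q : seq (edge E)).

Lemma prefix_total (T : eqType) (s1 s2 s : seq T) :
  prefix s1 s -> prefix s2 s -> prefix s1 s2 || prefix s2 s1.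
Proof.
elim: s1 s2 s => [|x s1 IH] [|y s2] [|z s] //=.
move=> /andP[/eqP -> h1] /andP[/eqP -> h2]; rewrite eqxx /=.
exact: IH h1 h2.
Qed.

Lemma prefix_cat2l (T : eqType) (s s1 s2 : seq T) : prefix (s ++ s1) (s ++ s2) = prefix s1 s2.
Proof. by rewrite prefix_catr // eqxx. Qed.

(** The part of p before its first visit to u. Visits are detected at sources, so a path meeting u
    only at its end is kept whole. *)
Fixpoint cut u p : seq (edge E) :=
  if p is f :: p' then if src f == u then [::] else f :: cut u p' else [::].

Lemma cut_notin u p : u \notin [seq src e | e <- cut u p].
Proof.
elim: p => //= f p IH; case: ifP => //= fu.
by rewrite inE negb_or IH eq_sym fu.
Qed.

Lemma cutP u v p : epath v p u ->
  exists q, [/\ p = cut u p ++ q, epath v (cut u p) u & epath u q u].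
Proof.
elim: p v => [|f p IH] v /=; first by move=> h; exists [::]; rewrite /= eqxx.
case/andP=> /eqP <- h; case: eqVneq => [fu|fu].
  by exists (f :: p); split=> //=; rewrite fu eqxx.
have [q [h1 h2 h3]] := IH _ h; exists q; rewrite /= {1}h1 eqxx.
by split.
Qed.

(** If p were a proper prefix, q would continue from u by an edge with source u. *)
Lemma first_visit_prefix u v p q : u \notin [seq src e | e <- q] ->
  epath v p u -> epath v q u -> prefix p q -> p = q.
Proof.
move=> nq hp hq /prefixP[[|f s] qE]; first by rewrite cats0 in qE.
rewrite qE (epath_cat _ _ hp) /= in hq; case/andP: hq => fu _.
case/negP: nq; rewrite qE map_cat mem_cat; apply/orP; right.
by rewrite /= (eqP fu) mem_head.
Qed.

Definition simple_at u d : bool := closed_simple_path d && based_at u d.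

Lemma simple_atP u e p :
  simple_at u (e :: p) = epath u (e :: p) u && (u \notin [seq src f | f <- p]).
Proof.
rewrite /simple_at /closed_simple_path.
have := closed_pathP u (e :: p); rewrite andbAC => -> /=.
by case: eqP => [->|].
Qed.

Lemma simple_at_epath u d : simple_at u d -> (d != [::]) /\ epath u d u.
Proof. by case: d => // e p; rewrite simple_atP => /andP[]. Qed.

Lemma first_return u c : c != [::] -> epath u c u ->
  exists d q, [/\ simple_at u d, epath u q u & c = d ++ q].
Proof.
case: c => // e p _ /= /andP[eu /cutP[q [pE h1 h2]]].
exists (e :: cut u p), q; rewrite simple_atP /= eu h1 cut_notin /= -pE.
by [].
Qed.

Lemma simple_at_prefix u d d' s : simple_at u d -> simple_at u d' ->
  prefix d s -> prefix d' s -> d = d'.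
Proof.
have key p p' : simple_at u p -> simple_at u p' -> prefix p p' -> p = p'.
  case: p p' => [|e p] [|e' p'] //; rewrite !simple_atP /=.
  move=> /andP[/andP[_ hp] _] /andP[/andP[_ hp'] n'] /andP[/eqP ee' pp'].
  by rewrite -ee' in hp' *; rewrite (first_visit_prefix n' hp hp' pp').
move=> hd hd' ds d's; have /orP[h|h] := prefix_total ds d's.
  exact: key.
by apply/esym/key.
Qed.

Lemma not_uniq_map (T U : eqType) (h : T -> U) (s : seq T) : ~~ uniq (map h s) ->
  exists a x b y s', s = a ++ x :: b ++ y :: s' /\ h x = h y.
Proof.
elim: s => //= x s IH; rewrite negb_and negbK => /orP[/mapP[y ys xy]|/IH].
  have [b s'] := splitPr ys; by exists [::], x, b, y, s'.
by move=> [a [y [b [z [s' [-> h']]]]]]; exists (x :: a), y, b, z, s'.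
Qed.

Lemma epath_src v p f q u : epath v (p ++ f :: q) u -> epath v p (src f) /\ epath (src f) (f :: q) u.
Proof. by case/epath_split=> z hp /= /andP[/eqP fz hq]; rewrite fz hp eqxx. Qed.

(** If d met a vertex twice, removing the part between the two visits would give a second, shorter
    simple closed path at u. *)
Lemma unique_simple_cycle u d : simple_at u d ->
  (forall d', simple_at u d' -> d' = d) -> Cu d.
Proof.
move=> hd ud; have /andP[cd bd] := hd; have /andP[cpd _] := cd.
split; last first.
  move=> v bv; exists d; split; first by rewrite cd bv.
  move=> d' [cd' bd']; apply/esym/ud; rewrite /simple_at cd' /=.
  by move: d' d {ud hd cd cpd cd'} bd bv bd' => [|e' p'] [|e p] //= /eqP <- /eqP <-.
rewrite /is_cycle cpd /=; apply: contrapT => /negP/not_uniq_map[a [f [b [g [s [dE fg]]]]]].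
(* The first of the two visits is not at the base, since a simple closed path does not leave u
   twice. *)
case: a dE => [|e a] dE; rewrite dE simple_atP in hd.
  case/andP: hd => /= /andP[/eqP fu _]; rewrite map_cat mem_cat /= inE -fg fu eqxx.
  by rewrite orbT.
case/andP: hd => /(@epath_src u (e :: a))[ha hf] nu.
have [hfb hg] : epath (src f) (f :: b) (src g) /\ epath (src g) (g :: s) u.
  by move: hf => /(@epath_src (src f) (f :: b)).
have /ud : simple_at u (e :: a ++ g :: s).
  rewrite simple_atP -cat_cons (epath_cat (p := e :: a) _ _ ha) fg hg /=.
  apply: contra nu; rewrite !map_cat /= !mem_cat !inE map_cat mem_cat /= inE.
  by case/orP=> [->|/orP[->|->]]; rewrite ?orbT.
by move/(congr1 size); rewrite dE /= !size_cat /= size_cat /=; lia.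
Qed.

Lemma Cu_unique u c : Cu c -> epath u c u -> c != [::] ->
  simple_at u c /\ forall d, simple_at u d -> d = c.
Proof.
move=> [/andP[cc uc] hu] h c0; have bc : based_at u c.
  by have := closed_pathP u c; rewrite h c0 cc.
have sc : simple_at u c.
  rewrite /simple_at /closed_simple_path cc bc andbT /=.
  by case: c uc {hu cc bc c0 h} => //= e p /andP[].
split=> // d /andP[cd bd]; have [x [[cx bx] ux]] := hu u bc.
have [c1 c2] := andP sc.
by rewrite -(ux d) // -(ux c).
Qed.

(** The part of p up to its first return to u is c, and what remains is a shorter closed path. *)
Lemma closed_path_power u c p : (forall d, simple_at u d -> d = c) ->
  epath u p u -> exists k, p = cyc c k.
Proof.
move=> uc; have [n] := ubnP (size p); elim: n p => // n IH p ps hp.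
have [->|p0] := eqVneq p [::]; first by exists 0%N.
have [d [q [hd hq pE]]] := first_return p0 hp.
have [d0 _] := simple_at_epath hd.
have [|k qE] := IH q _ hq.
  by move: ps; rewrite pE size_cat; case: (d) d0 => //= *; lia.
by exists k.+1; rewrite pE qE -(uc d hd).
Qed.

Definition incomparable p q := ~~ prefix p q && ~~ prefix q p.

(* With no closed path at [u] the ends of distinct paths to [u] need no
   extension; with two simple ones [d1], [d2], appending [d1^k d2] destroys any
   overlap shorter than [k]. *)
Lemma separating_path u : (forall d, simple_at u d -> Cu d -> False) ->
  forall N, exists2 t, epath u t u &
    forall v p q, epath v p u -> epath v q u -> p != q ->
      (size p <= N)%N -> (size q <= N)%N -> incomparable (p ++ t) (q ++ t).
Proof.
move=> nC N.
(* If p t were a prefix of q t, then q = p g with g closed at u, and t would be a prefix of g t. *)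
suff [t ht tP] : exists2 t, epath u t u & forall g, epath u g u -> g != [::] ->
    (size g <= N)%N -> ~~ prefix t (g ++ t).
  exists t => // v p q hp hq pq sp sq.
  have key p' q' : epath v p' u -> epath v q' u -> p' != q' -> (size q' <= N)%N ->
      ~~ prefix (p' ++ t) (q' ++ t).
    move=> hp' hq' pq' sq'; apply/negP => pre.
    have sz := size_prefix pre; rewrite !size_cat leq_add2r in sz.
    have pre' := prefix_trans (prefix_prefix p' t) pre.
    have /orP[/prefixP[g qE]|/prefixP[[|f g] pE]] :=
      prefix_total pre' (prefix_prefix q' t); last 2 first.
    - by case/eqP: pq'; rewrite pE cats0.
    - by move: sz; rewrite pE size_cat /=; lia.
    rewrite qE -catA in pre; rewrite prefix_cat2l in pre.
    move: pre; apply/negP; apply: tP.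
    - by move: hq'; rewrite qE (epath_cat _ _ hp').
    - by apply: contra pq' => /eqP g0; rewrite qE g0 cats0.
    - by move: sq'; rewrite qE size_cat; lia.
  by rewrite /incomparable !key // eq_sym.
have [[d1 hd1]|nd] := pselect (exists d, simple_at u d); last first.
  exists [::]; first by rewrite /= eqxx.
  move=> g hg g0 _; exfalso; apply: nd.
  by have [d [q []]] := first_return g0 hg; exists d.
have [d2 hd2 d21] : exists2 d2, simple_at u d2 & d2 != d1.
  apply: contrapT => h; apply: (nC d1 hd1); apply: unique_simple_cycle hd1 _ => d' hd'.
  by apply: contrapT => /eqP dd; apply: h; exists d'.
have [d10 pd1] := simple_at_epath hd1; have [d20 pd2] := simple_at_epath hd2.
have cS k : cyc d1 k.+1 = d1 ++ cyc d1 k by [].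
(* Blocks d1 are cancelled on both sides, since the first block of g must be d1. Once g is used up,
   j < m leaves a further d1 facing d2, and two distinct simple closed paths have no common
   extension. *)
have step m g j : epath u g u -> (size g <= j)%N -> (j < m)%N ->
    ~~ prefix (cyc d1 j ++ d2) (g ++ cyc d1 m ++ d2).
  have [n] := ubnP (size g); elim: n g j => // n IH g j gn hg gj jm.
  apply/negP; have [->|g0] := eqVneq g [::].
    rewrite /= -{1}(subnKC (ltnW jm)) cycD -catA prefix_cat2l.
    rewrite -[(m - j)%N]prednK ?subn_gt0 // cS -catA => pre.
    case/eqP: d21; apply: (simple_at_prefix hd2 hd1 pre).
    exact: prefix_prefix.
  have [d [q [hd hq gE]]] := first_return g0 hg.
  have [d0 _] := simple_at_epath hd.
  case: j gj jm => [|j] gj jm; first by case: (g) g0 gj.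
  rewrite gE cS -!catA => pre.
  have dd : d = d1.
    apply: (simple_at_prefix hd hd1 (prefix_prefix _ _)).
    by apply: prefix_trans pre; exact: prefix_prefix.
  move: pre; rewrite dd prefix_cat2l; apply/negP.
  have : (0 < size d)%N by case: (d) d0.
  by move: gn gj; rewrite gE size_cat => gn gj dp; apply: IH => //; lia.
exists (cyc d1 N.+1 ++ d2); first by rewrite (epath_cat _ _ (epath_cyc _ pd1)).
(* As g is not empty, one block cancels at once; this leaves the exponents N and N+1 required by
   [step]. *)
move=> g hg g0 gN; have [d [q [hd hq gE]]] := first_return g0 hg.
apply/negP; rewrite gE cS -!catA => pre.
have dd : d = d1.
  apply: (simple_at_prefix hd hd1 (prefix_prefix _ _)).
  by apply: prefix_trans pre; exact: prefix_prefix.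
move: pre; rewrite dd prefix_cat2l; apply/negP.
have -> : d1 ++ cyc d1 N ++ d2 = cyc d1 N.+1 ++ d2 by rewrite cS catA.
apply: step => //.
have [d0 _] := simple_at_epath hd.
have : (0 < size d)%N by case: (d) d0.
by move: gN; rewrite gE size_cat; lia.
Qed.

End PathCombinatorics.

(** * Linear combinations indexed by lists *)

Section Spans.
Context (R : comPzRingType) (T : eqType) (A : lmodType R).
Implicit Types (b : T -> A) (D : seq T) (P : pred T).

Definition span_on b D (a : A) : Prop := exists S : T -> R, a = \sum_(x <- D) S x *: b x.

Definition span_of b P (a : A) : Prop := exists D, [/\ uniq D, all P D & span_on b D a].

Lemma span_on_sub b D D' a : uniq D -> uniq D' -> {subset D <= D'} ->
  span_on b D a -> span_on b D' a.
Proof.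
move=> uD uD' DD' [S ->]; exists (fun x => if x \in D then S x else 0).
rewrite [RHS](eq_bigr (fun x => if x \in D then S x *: b x else 0)); last first.
  by move=> x _; case: ifP; rewrite ?scale0r.
rewrite -big_mkcond -[RHS]big_filter; apply: perm_big.
apply: uniq_perm => //; first exact: filter_uniq.
by move=> x; rewrite mem_filter; case: (boolP (x \in D)) => //= /DD' ->.
Qed.

Lemma span_on_undup b D D' a : uniq D -> {subset D <= D'} ->
  span_on b D a -> span_on b (undup D') a.
Proof.
by move=> uD DD'; apply: span_on_sub; rewrite ?undup_uniq // => x /DD'; rewrite mem_undup.
Qed.

Lemma all_undup P D : all P D -> all P (undup D).
Proof. by move=> /allP h; apply/allP => x; rewrite mem_undup => /h. Qed.

Lemma span_of0 b P : span_of b P 0.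
Proof. by exists [::]; split=> //; exists (fun=> 0); rewrite big_nil. Qed.

Lemma span_of_mem b P x : P x -> span_of b P (b x).
Proof.
by move=> Px; exists [:: x]; rewrite /= Px; split=> //; exists (fun=> 1); rewrite big_seq1 scale1r.
Qed.

Lemma span_ofZ b P s a : span_of b P a -> span_of b P (s *: a).
Proof.
move=> [D [uD PD [S ->]]]; exists D; split=> //; exists (fun x => s * S x).
by rewrite scaler_sumr; apply: eq_bigr => x _; rewrite scalerA.
Qed.

Lemma span_ofD b P a a' : span_of b P a -> span_of b P a' -> span_of b P (a + a').
Proof.
move=> [D [uD PD hD]] [D' [uD' PD' hD']].
exists (undup (D ++ D')); split; rewrite ?undup_uniq ?all_undup ?all_cat ?PD //.
have [S ->] : span_on b (undup (D ++ D')) a.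
  by apply: span_on_undup hD => // x; rewrite mem_cat => ->.
have [S' ->] : span_on b (undup (D ++ D')) a'.
  by apply: span_on_undup hD' => // x; rewrite mem_cat orbC => ->.
exists (fun x => S x + S' x); rewrite -big_split.
by apply: eq_bigr => x _; rewrite scalerDl.
Qed.

(** A common list allows coefficients of different elements to be compared index by index. *)
Lemma span_of_common b P n (a : 'I_n -> A) : (forall i, span_of b P (a i)) ->
  exists D, [/\ uniq D, all P D & forall i, span_on b D (a i)].
Proof.
move=> /boolp.choice[d hd].
exists (undup (flatten [seq d i | i <- enum 'I_n])); rewrite undup_uniq; split=> //.
  apply/all_undup/allP => x /flattenP[_ /mapP[i _ ->]].
  by have [_ /allP h _] := hd i; exact: h.
move=> i; have [ud _ hi] := hd i; apply: span_on_undup hi => // x xd.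
by apply/flattenP; exists (d i) => //; apply: map_f; rewrite mem_enum.
Qed.

End Spans.

(** * Localization of elements of IJ at a vertex *)

Section Localization.
Context (R : comPzRingType) (E : digraph).
Implicit Types (u v w : vertex E) (p q : seq (edge E)) (F : seq (edge E)).
Local Notation V := (@lpa_vertex R E).
Local Notation X := (@lpa_edge R E).
Local Notation G := (@lpa_ghost R E).
Local Notation L := (lpa R E).

Definition pe (x : vertex E * seq (edge E)) : L := pel R x.1 x.2.
Definition ge (x : vertex E * seq (edge E)) : L := gel R x.1 x.2.
Definition ends u (x : vertex E * seq (edge E)) : bool := epath x.1 x.2 u.

Definition gspan u : set L := [set a | span_of ge (ends u) a].
Definition pspan u : set L := [set a | span_of pe (ends u) a].

Lemma gspan_gel u v q : epath v q u -> gspan u (gel R v q).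
Proof. exact: (@span_of_mem _ _ _ ge (ends u) (v, q)). Qed.

Lemma pspan_pel u v q : epath v q u -> pspan u (pel R v q).
Proof. exact: (@span_of_mem _ _ _ pe (ends u) (v, q)). Qed.

(** For m at least as long as p, either p is a prefix of m and m^* p q^* is a ghost path, or m^* p =
    0. *)
Lemma ghost_absorb (x : L) : exists N, forall v m u, epath v m u -> (N <= size m)%N ->
  gspan u (gel R v m ** x).
Proof.
elim: (monomial_sumT x) => [|y z _ [N1 h1] _ [N2 h2]|s v1 p v2 q w hp hq].
- by exists 0%N => v m u _ _; rewrite lpa_mul0r; exact: span_of0.
- exists (maxn N1 N2) => v m u hm; rewrite geq_max => /andP[n1 n2].
  by rewrite lpa_mulDr; apply: span_ofD; [exact: h1|exact: h2].
exists (size p) => v m u hm pm; rewrite lpa_scaleAr; apply: span_ofZ.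
rewrite lpa_mulA; have [vE|nv] := eqVneq v v1; last first.
  by rewrite (gel_pel_start R hm hp nv) lpa_mul0l; exact: span_of0.
rewrite {}vE {v} in hm *.
have [/prefixP[m' mE]|npm] := boolP (prefix p m).
  rewrite mE (epath_cat _ _ hp) in hm.
  rewrite mE (gel_cat_pel R hp hm) -(gel_cat R hq hm).
  by apply: gspan_gel; rewrite (epath_cat _ _ hq).
rewrite (gel_pel_incomparable R hm hp) // ?lpa_mul0l; first exact: span_of0.
apply: contra npm => /prefixP[m' mE]; move: pm; rewrite mE size_cat.
by case: m' {mE hp hm} => [|f m'] /=; rewrite ?cats0 ?prefix_refl //; lia.
Qed.

Lemma path_absorb (x : L) : exists N, forall v m u, epath v m u -> (N <= size m)%N ->
  pspan u (x ** pel R v m).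
Proof.
elim: (monomial_sumT x) => [|y z _ [N1 h1] _ [N2 h2]|s v1 p v2 q w hp hq].
- by exists 0%N => v m u _ _; rewrite lpa_mul0l; exact: span_of0.
- exists (maxn N1 N2) => v m u hm; rewrite geq_max => /andP[n1 n2].
  by rewrite lpa_mulDl; apply: span_ofD; [exact: h1|exact: h2].
exists (size q) => v m u hm qm; rewrite lpa_scaleAl; apply: span_ofZ.
rewrite -lpa_mulA; have [vE|nv] := eqVneq v2 v; last first.
  by rewrite (gel_pel_start R hq hm nv) lpa_mul0r; exact: span_of0.
rewrite -{}vE {v} in hm *.
have [/prefixP[m' mE]|nqm] := boolP (prefix q m).
  rewrite mE (epath_cat _ _ hq) in hm.
  rewrite mE (gel_pel_cat R hq hm) -(pel_cat R hp hm).
  by apply: pspan_pel; rewrite (epath_cat _ _ hp).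
rewrite (gel_pel_incomparable R hq hm) // ?lpa_mul0r; first exact: span_of0.
apply: contra nqm => /prefixP[m' mE]; move: qm; rewrite mE size_cat.
by case: m' {mE hq hm} => [|f m'] /=; rewrite ?cats0 ?prefix_refl //; lia.
Qed.

(** [trunc w F] annihilates the edges from w in F. Once F contains the first edges of the paths in
    x, only the monomials p q^* with p equal to the vertex w survive. *)
Lemma trunc_absorbl (x : L) w : exists F0 a, gspan w a /\
  forall F, uniq F -> {subset F0 <= F} -> trunc R w F ** x = trunc R w F ** a.
Proof.
elim: (monomial_sumT x) => [|y z _ [F1 [a1 [ga1 h1]]] _ [F2 [a2 [ga2 h2]]]|s v1 p v2 q w' hp hq].
- by exists [::], 0; split=> //; exact: span_of0.
- exists (F1 ++ F2), (a1 + a2); split; first exact: span_ofD.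
  move=> F uF hF; rewrite !lpa_mulDr h1 ?h2 // => e eF; apply: hF;
    by rewrite mem_cat eF ?orbT.
have [wE|nw] := eqVneq w v1; last first.
  exists [::], 0; split; first exact: span_of0.
  move=> F uF _; rewrite lpa_scaleAr -trunc_v -lpa_mulA.
  by rewrite -(mul_v_pel R hp) !(lpa_mulA (V w)) (mul_vw R nw) !lpa_mul0l !lpa_mul0r scaler0.
rewrite -{}wE {v1} in hp *; case: p hp => [|e p] /= hp.
  exists [::], (s *: gel R v2 q); split.
    by apply/span_ofZ/gspan_gel; rewrite (eqP hp).
  by move=> F uF _; rewrite !lpa_scaleAr lpa_mulA trunc_v.
exists [:: e], 0; split; first exact: span_of0.
move=> F uF eF; rewrite lpa_scaleAr !lpa_mulA (trunc_edge R uF); last first.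
  by case/andP: hp => /eqP.
by rewrite eF ?mem_head // !lpa_mul0l lpa_mul0r scaler0.
Qed.

Lemma trunc_absorbr (x : L) w : exists F0 b, pspan w b /\
  forall F, uniq F -> {subset F0 <= F} -> x ** trunc R w F = b ** trunc R w F.
Proof.
elim: (monomial_sumT x) => [|y z _ [F1 [a1 [ga1 h1]]] _ [F2 [a2 [ga2 h2]]]|s v1 p v2 q w' hp hq].
- by exists [::], 0; split=> //; exact: span_of0.
- exists (F1 ++ F2), (a1 + a2); split; first exact: span_ofD.
  move=> F uF hF; rewrite !lpa_mulDl h1 ?h2 // => e eF; apply: hF;
    by rewrite mem_cat eF ?orbT.
have [wE|nw] := eqVneq v2 w; last first.
  exists [::], 0; split; first exact: span_of0.
  move=> F uF _; rewrite lpa_scaleAl -v_trunc lpa_mulA.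
  by rewrite -(mul_gel_v R hq) -!lpa_mulA (lpa_mulA (V v2)) (mul_vw R nw) !lpa_mul0l !lpa_mul0r scaler0.
rewrite {}wE {v2} in hq *; case: q hq => [|e q] /= hq.
  exists [::], (s *: pel R v1 p); split.
    by apply/span_ofZ/pspan_pel; rewrite (eqP hq).
  by move=> F uF _; rewrite !lpa_scaleAl -lpa_mulA v_trunc.
exists [:: e], 0; split; first exact: span_of0.
move=> F uF eF; rewrite lpa_scaleAl -!lpa_mulA (ghost_trunc R uF); last first.
  by case/andP: hq => /eqP.
by rewrite eF ?mem_head // !lpa_mul0l !lpa_mul0r scaler0.
Qed.

Section TwoIdeals.
Variables (I J : set L) (idI : ideal (@lpa_mul R E) I) (idJ : ideal (@lpa_mul R E) J).
Local Notation IJ := (ideal_mul (@lpa_mul R E) I J).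

(** Membership in I and J is asked only after multiplication by k: absorption replaces x in I by a
    with k x = k a, and a itself may lie outside I. *)
Definition local_product u (k : L) : set L :=
  ideal_mul (@lpa_mul R E) [set a | gspan u a /\ I (k ** a)] [set b | pspan u b /\ J (b ** k)].

Lemma path_localization z : IJ z -> exists N, forall v m u, epath v m u ->
  (N <= size m)%N -> local_product u (V u) (gel R v m ** z ** pel R v m).
Proof.
move: z; apply: ideal_mul_ind => [|x y [N1 h1] [N2 h2]|x y Ix Jy].
- by exists 0%N => v m u _ _; rewrite lpa_mul0r lpa_mul0l; exact: ideal_mul0.
- exists (maxn N1 N2) => v m u hm; rewrite geq_max => /andP[n1 n2].
  by rewrite lpa_mulDr lpa_mulDl; apply: ideal_mulD; [exact: h1|exact: h2].
have [N1 h1] := ghost_absorb x; have [N2 h2] := path_absorb y.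
exists (maxn N1 N2) => v m u hm; rewrite geq_max => /andP[n1 n2].
rewrite lpa_mulA -lpa_mulA; apply: ideal_mul_gen; split.
- exact: h1.
- by do 2!apply: (ideal_closedMl idI).
- exact: h2.
- by do 2!apply: (ideal_closedMr idJ).
Qed.

Lemma trunc_localization z w : IJ z -> exists F0, forall F, uniq F -> {subset F0 <= F} ->
  exists2 t, local_product w (trunc R w F) t &
    trunc R w F ** z ** trunc R w F = trunc R w F ** t ** trunc R w F.
Proof.
move: z; apply: ideal_mul_ind => [|x y [F1 h1] [F2 h2]|x y Ix Jy].
- exists [::] => F _ _; exists 0; last by [].
  exact: ideal_mul0.
- exists (F1 ++ F2) => F uF hF.
  have [|t1 l1 e1] := h1 F uF; first by move=> e eF; apply: hF; rewrite mem_cat eF.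
  have [|t2 l2 e2] := h2 F uF; first by move=> e eF; apply: hF; rewrite mem_cat eF orbT.
  exists (t1 + t2); first exact: ideal_mulD.
  have sandwichD k a b : k ** (a + b) ** k = k ** a ** k + k ** b ** k :> L.
    by rewrite lpa_mulDr lpa_mulDl.
  by rewrite !sandwichD e1 e2.
have [F1 [a [ga ha]]] := trunc_absorbl x w; have [F2 [b [pb hb]]] := trunc_absorbr y w.
exists (F1 ++ F2) => F uF hF.
have ea : trunc R w F ** x = trunc R w F ** a.
  by apply: ha => // e eF; apply: hF; rewrite mem_cat eF.
have eb : y ** trunc R w F = b ** trunc R w F.
  by apply: hb => // e eF; apply: hF; rewrite mem_cat eF orbT.
exists (a ** b); last by rewrite !lpa_mulA ea -!lpa_mulA eb.
apply: ideal_mul_gen; split=> //=; first by rewrite -ea; exact: ideal_closedMl.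
by rewrite -eb; exact: ideal_closedMr.
Qed.

(* Sandwiching between [k'] and [k] that annihilate all products of distinct
   paths leaves only the diagonal terms. *)
Lemma local_product_diagonal u k0 t : local_product u k0 t ->
  exists D, all (ends u) D /\ forall k' k z, k' ** k0 = k' -> k0 ** k = k ->
    (forall x y, x \in D -> y \in D ->
       k' ** ge x ** pe y ** k = if x == y then z else 0) ->
    exists2 r, k' ** t ** k = r *: z &
      ideal_mul *%R [set s | I (s *: z)] [set s | J (s *: z)] r.
Proof.
move=> [n [a [b [ha hb ->]]]].
have [D1 [uD1 eD1 hD1]] := @span_of_common _ _ _ ge (ends u) n a (fun i => (ha i).1).
have [D2 [uD2 eD2 hD2]] := @span_of_common _ _ _ pe (ends u) n b (fun i => (hb i).1).
pose D := undup (D1 ++ D2); have uD : uniq D by exact: undup_uniq.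
exists D; split; first by rewrite all_undup // all_cat eD1.
move=> k' k z k'0 k0k kill.
have /boolp.choice[S hS] i : exists S, a i = \sum_(x <- D) S x *: ge x.
  by apply: span_on_undup (hD1 i) => // x; rewrite mem_cat => ->.
have /boolp.choice[T hT] i : exists T, b i = \sum_(x <- D) T x *: pe x.
  by apply: span_on_undup (hD2 i) => // x; rewrite mem_cat orbC => ->.
(* Multiplying by one path isolates its coefficient, which shows that this coefficient times z lies
   in I. *)
have eS i x : x \in D -> k' ** a i ** pe x ** k = S i x *: z.
  move=> xD; rewrite hS lpa_sumr !lpa_suml (bigD1_seq x) //= big_seq_cond big1.
    by rewrite addr0 lpa_scaleAr !lpa_scaleAl kill // eqxx.
  move=> y /andP[yD yx].
  by rewrite lpa_scaleAr !lpa_scaleAl kill // (negPf yx) scaler0.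
have eT i x : x \in D -> k' ** ge x ** b i ** k = T i x *: z.
  move=> xD; rewrite hT lpa_sumr !lpa_suml (bigD1_seq x) //= big_seq_cond big1.
    by rewrite addr0 lpa_scaleAr !lpa_scaleAl kill // eqxx.
  move=> y /andP[yD yx].
  by rewrite lpa_scaleAr !lpa_scaleAl kill // eq_sym (negPf yx) scaler0.
exists (\sum_i \sum_(x <- D) S i x * T i x).
  rewrite lpa_sumr lpa_suml scaler_suml; apply: eq_bigr => i _.
  rewrite {1}hS lpa_suml lpa_sumr lpa_suml scaler_suml big_seq [RHS]big_seq.
  apply: eq_bigr => x xD.
  by rewrite lpa_scaleAl lpa_scaleAr !lpa_scaleAl lpa_mulA eT // scalerA.
apply: ideal_mul_sum => i; rewrite big_seq; apply: (big_ind (ideal_mul _ _ _)).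
- exact: ideal_mul0.
- exact: ideal_mulD.
move=> x xD; apply: ideal_mul_gen => /=.
  rewrite -eS // -{1}k'0 -(lpa_mulA k').
  by do 2!apply: (ideal_closedMr idI); apply: (ideal_closedMl idI); case: (ha i).
rewrite -eT //; have -> : k' ** ge x ** b i ** k = k' ** ge x ** (b i ** k0) ** k.
  by rewrite -{1}k0k !lpa_mulA.
by apply/(ideal_closedMr idJ)/(ideal_closedMl idJ); case: (hb i).
Qed.

Section UniqueCycle.
Variables (u : vertex E) (c : seq (edge E)).
Hypotheses (Cuc : Cu c) (c0 : c != [::]) (hc : epath u c u).

Let uniq_simple d : simple_at u d -> d = c := (Cu_unique Cuc hc c0).2 d.

(** The path up to its first arrival at u. The rest is a power of c, the only simple closed path at
    u. *)
Let stem (x : vertex E * seq (edge E)) := (x.1, cut u x.2).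

Lemma ends_stem x : ends u x -> ends u (stem x) /\ exists k, x.2 = (stem x).2 ++ cyc c k.
Proof.
move=> /cutP[q [xE h1 h2]]; split=> //.
by have [k qE] := closed_path_power uniq_simple h2; exists k; rewrite {1}xE qE.
Qed.

(** A stem meets u only at its end, so distinct stems with the same start are incomparable. *)
Lemma gel_pel_stem x y : ends u x -> ends u y ->
  ge (stem x) ** pe (stem y) = if stem x == stem y then V u else 0.
Proof.
move=> /ends_stem[hx _] /ends_stem[hy _].
case: eqVneq => [<-|]; first exact: gel_pel.
move=> ne; have [xy|nxy] := eqVneq x.1 y.1; last exact: (gel_pel_start R hx hy).
rewrite /ge /pe; move: hx hy ne; rewrite /ends /stem /= -xy => hx hy ne.
have nC : cut u x.2 != cut u y.2 by apply: contra ne => /eqP ->.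
apply: (gel_pel_incomparable R hx hy).
  by apply: contra nC => h; apply/eqP; apply: first_visit_prefix hx hy h; exact: cut_notin.
apply: contra nC => h; apply/eqP/esym.
by apply: first_visit_prefix hy hx h; exact: cut_notin.
Qed.

Lemma lsupp_lmono a n m : m \in lsupp (lmono a n : laurent R) -> m = n.
Proof.
have /fsubsetP/[apply] : (lsupp (lmono a n : laurent R) `<=` [fset n])%fset.
  exact: monalg.msuppU_le.
by rewrite inE => /eqP.
Qed.

Lemma lsuppD (K : pred int) (P Q : laurent R) :
  {in lsupp P, forall n, K n} -> {in lsupp Q, forall n, K n} ->
  {in lsupp (P + Q), forall n, K n}.
Proof.
move=> hP hQ n hn; have : n \in (lsupp P `|` lsupp Q)%fset.
  by move: n hn; apply/fsubsetP; exact: monalg.msuppD_le.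
by rewrite inE => /orP[/hP|/hQ].
Qed.

Lemma lsupp0 (K : pred int) : {in lsupp (0 : laurent R), forall n, K n}.
Proof. by move=> n; rewrite /lsupp monalg.msupp0 inE. Qed.

(** A path is its stem followed by c^k, so its ghost is c^(-k) times the ghost of the stem.
    Collecting equal stems turns scalars into Laurent polynomials. *)
Lemma gspan_stems D a : all (ends u) D -> span_on ge D a ->
  exists P : vertex E * seq (edge E) -> laurent R,
    (forall y, {in lsupp (P y), forall n, (n <= 0)%R}) /\
    a = \sum_(y <- undup (map stem D)) lpa_eval (P y) c ** ge y.
Proof.
move=> /allP eD [S ->]; rewrite big_seq.
apply: (big_ind (fun a => exists P : vertex E * seq (edge E) -> laurent R,
    (forall y, {in lsupp (P y), forall n, (n <= 0)%R}) /\
    a = \sum_(y <- undup (map stem D)) lpa_eval (P y) c ** ge y)).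
- exists (fun=> 0); split; first by move=> _; exact: (@lsupp0 (fun n => (n <= 0)%R)).
  by rewrite big1 // => y _; rewrite lpa_eval0 lpa_mul0l.
- move=> _ _ [P [sP ->]] [Q [sQ ->]]; exists (fun y => P y + Q y); split.
    by move=> y; apply: (@lsuppD (fun n => (n <= 0)%R)).
  by rewrite -big_split; apply: eq_bigr => y _; rewrite lpa_evalD lpa_mulDl.
move=> x xD; have [hs [k xE]] := ends_stem (eD _ xD).
exists (fun y => if y == stem x then lmono (S x) (- k%:Z) else 0); split.
  move=> y; case: ifP => _; last exact: (@lsupp0 (fun n => (n <= 0)%R)).
  by move=> n /lsupp_lmono ->; lia.
rewrite (bigD1_seq (stem x)) ?undup_uniq ?mem_undup ?map_f //= eqxx big1; last first.
  by move=> y /negPf ->; rewrite lpa_eval0 lpa_mul0l.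
rewrite addr0 lpa_eval_lmono lpa_scaleAl (lpa_cycle_powN R c0 hc).
by rewrite /ge xE (gel_cat R hs (epath_cyc k hc)).
Qed.

Lemma pspan_stems D b : all (ends u) D -> span_on pe D b ->
  exists P : vertex E * seq (edge E) -> laurent R,
    (forall y, {in lsupp (P y), forall n, (0 <= n)%R}) /\
    b = \sum_(y <- undup (map stem D)) pe y ** lpa_eval (P y) c.
Proof.
move=> /allP eD [S ->]; rewrite big_seq.
apply: (big_ind (fun a => exists P : vertex E * seq (edge E) -> laurent R,
    (forall y, {in lsupp (P y), forall n, (0 <= n)%R}) /\
    a = \sum_(y <- undup (map stem D)) pe y ** lpa_eval (P y) c)).
- exists (fun=> 0); split; first by move=> _; exact: (@lsupp0 (fun n => (0 <= n)%R)).
  by rewrite big1 // => y _; rewrite lpa_eval0 lpa_mul0r.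
- move=> _ _ [P [sP ->]] [Q [sQ ->]]; exists (fun y => P y + Q y); split.
    by move=> y; apply: (@lsuppD (fun n => (0 <= n)%R)).
  by rewrite -big_split; apply: eq_bigr => y _; rewrite lpa_evalD lpa_mulDr.
move=> x xD; have [hs [k xE]] := ends_stem (eD _ xD).
exists (fun y => if y == stem x then lmono (S x) k%:Z else 0); split.
  move=> y; case: ifP => _; last exact: (@lsupp0 (fun n => (0 <= n)%R)).
  by move=> n /lsupp_lmono ->; lia.
rewrite (bigD1_seq (stem x)) ?undup_uniq ?mem_undup ?map_f //= eqxx big1; last first.
  by move=> y /negPf ->; rewrite lpa_eval0 lpa_mul0r.
rewrite addr0 lpa_eval_lmono lpa_scaleAr (lpa_cycle_powP R c0 hc).
by rewrite /pe xE (pel_cat R hs (epath_cyc k hc)).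
Qed.

Lemma v_lpa_eval (P : laurent R) : V u ** lpa_eval P c = lpa_eval P c.
Proof.
rewrite /lpa_eval lpa_sumr; apply: eq_bigr => n _; rewrite lpa_scaleAr; congr (_ *: _).
by rewrite -(lpa_cycle_powP R c0 hc 0 : _ = V u) -(lpa_cycle_powDl R c0 hc 0) add0r.
Qed.

Lemma lpa_eval_v (P : laurent R) : lpa_eval P c ** V u = lpa_eval P c.
Proof.
rewrite /lpa_eval lpa_suml; apply: eq_bigr => n _; rewrite lpa_scaleAl; congr (_ *: _).
by rewrite -(lpa_cycle_powP R c0 hc 0 : _ = V u) -(lpa_cycle_powDr R c0 hc _ 0) addr0.
Qed.

(* Grouping paths to [u] by their first arrival at [u] turns a local product
   into a sum of products of Laurent polynomials in [c]. *)
Lemma local_product_cycle (P : laurent R) : local_product u (V u) (lpa_eval P c) ->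
  ideal_mul *%R (pair_g I c) (pair_g J c) P.
Proof.
move=> [n [a [b [ha hb PE]]]].
have [D1 [uD1 eD1 hD1]] := @span_of_common _ _ _ ge (ends u) n a (fun i => (ha i).1).
have [D2 [uD2 eD2 hD2]] := @span_of_common _ _ _ pe (ends u) n b (fun i => (hb i).1).
pose D := undup (D1 ++ D2); have uD : uniq D by exact: undup_uniq.
have eD : all (ends u) D by rewrite all_undup // all_cat eD1.
pose K := undup (map stem D); have uK : uniq K by exact: undup_uniq.
have killK x y : x \in K -> y \in K -> ge x ** pe y = if x == y then V u else 0.
  rewrite !mem_undup => /mapP[x' /(allP eD) hx ->] /mapP[y' /(allP eD) hy ->].
  exact: gel_pel_stem.
have /boolp.choice[S hS] i : exists S : _ -> laurent R,
    (forall y, {in lsupp (S y), forall n, (n <= 0)%R}) /\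
    a i = \sum_(y <- K) lpa_eval (S y) c ** ge y.
  by apply: gspan_stems => //; apply: span_on_undup (hD1 i) => // x; rewrite mem_cat => ->.
have /boolp.choice[T hT] i : exists T : _ -> laurent R,
    (forall y, {in lsupp (T y), forall n, (0 <= n)%R}) /\
    b i = \sum_(y <- K) pe y ** lpa_eval (T y) c.
  by apply: pspan_stems => //; apply: span_on_undup (hD2 i) => // x; rewrite mem_cat orbC => ->.
(* Multiplying by a stem isolates its polynomial, which therefore lies in g_I(c). *)
have eS i x : x \in K -> V u ** a i ** pe x = lpa_eval (S i x) c.
  move=> xK; rewrite (hS i).2 lpa_sumr !lpa_suml (bigD1_seq x) //= big_seq_cond big1.
    by rewrite addr0 lpa_mulA v_lpa_eval -lpa_mulA killK // eqxx lpa_eval_v.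
  by move=> y /andP[yK yx]; rewrite lpa_mulA -lpa_mulA killK // (negPf yx) lpa_mul0r.
have eT i x : x \in K -> ge x ** b i = lpa_eval (T i x) c.
  move=> xK; rewrite (hT i).2 lpa_sumr (bigD1_seq x) //= big_seq_cond big1.
    by rewrite addr0 lpa_mulA killK // eqxx v_lpa_eval.
  by move=> y /andP[yK yx]; rewrite lpa_mulA killK // eq_sym (negPf yx) lpa_mul0l.
(* Evaluation is injective, and multiplicative here because the second factors have no negative
   exponents. *)
have -> : P = \sum_i \sum_(x <- K) S i x * T i x.
  apply: (lpa_eval_inj c0 hc); rewrite PE lpa_eval_sum; apply: eq_bigr => i _.
  rewrite {1}(hS i).2 lpa_suml lpa_eval_sum big_seq [RHS]big_seq.
  apply: eq_bigr => x xK; rewrite -lpa_mulA eT // (lpa_evalMr c0 hc) //.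
  exact: (hT i).1.
apply: ideal_mul_sum => i; rewrite big_seq; apply: (big_ind (ideal_mul _ _ _)).
- exact: ideal_mul0.
- exact: ideal_mulD.
move=> x xK; apply: ideal_mul_gen; rewrite /pair_g /=.
  by rewrite -eS //; apply: (ideal_closedMr idI); case: (ha i).
rewrite -eT //.
(* The factor u is restored because it is b_i u that is known to lie in J. *)
have -> : ge x ** b i = ge x ** (b i ** V u) by rewrite lpa_mulA eT // lpa_eval_v.
by apply: (ideal_closedMl idJ); case: (hb i).
Qed.

End UniqueCycle.

End TwoIdeals.

End Localization.

(** * The pair of the product ideal *)

Section ProductOfIdeals.
Context (R : comPzRingType) (E : digraph) (I J : set (lpa R E)).
Hypotheses (idI : ideal (@lpa_mul R E) I) (idJ : ideal (@lpa_mul R E) J).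
Implicit Types (u v w : vertex E) (c : seq (edge E)) (F : seq (edge E)).
Local Notation V := (@lpa_vertex R E).
Local Notation X := (@lpa_edge R E).
Local Notation G := (@lpa_ghost R E).
Local Notation IJ := (ideal_mul (@lpa_mul R E) I J).

Lemma Cu_epath c : Cu c -> exists u, c != [::] /\ epath u c u.
Proof.
case: c => [[/andP[//]]|e p] [/andP[cc _] _]; exists (src e); split=> //.
have := closed_pathP (src e) (e :: p); rewrite cc /= eqxx => /esym.
by [].
Qed.

(** The identity c^(-N) p(c) c^N = p(c) holds for every N, and for large N its left side is a local
    product at u. *)
Lemma pair_g_product c : Cu c ->
  pair_g IJ c `<=` ideal_mul *%R (pair_g I c) (pair_g J c).
Proof.
move=> Cc P hP; have [u [c0 hc]] := Cu_epath Cc.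
apply: (local_product_cycle idI idJ Cc c0 hc).
have [N hN] := path_localization idI idJ hP.
have := hN u (cyc c N) u (epath_cyc N hc).
rewrite size_cyc => /(_ _); rewrite -(lpa_cycle_powN R c0 hc) -(lpa_cycle_powP R c0 hc).
have -> : lpa_cycle_pow R c (- N%:Z) ** lpa_eval P c ** lpa_cycle_pow R c N%:Z = lpa_eval P c.
  rewrite -[lpa_cycle_pow R c (- N%:Z)]scale1r -[lpa_cycle_pow R c N%:Z]scale1r.
  rewrite -!lpa_eval_lmono -(lpa_evalMl c0 hc); last first.
    by move=> n /lsupp_lmono ->; lia.
  rewrite -(lpa_evalMr c0 hc); last by move=> n /lsupp_lmono ->.
  rewrite mulrAC [X in X * _](laurent_mulUU 1 1) mulr1 addNr.
  by rewrite [X in X * _](_ : _ = 1) // mul1r.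
by apply; rewrite leq_pmulr // lt0n size_eq0.
Qed.

(** An edge e from w outside F turns [trunc w F] into the range of e. Without such an edge w emits
    finitely many edges, hence none as it is not regular, and [trunc w F] is w. *)
Lemma trunc_torsion_free w F (a b : R) : uniq F -> ~ regular w ->
  a *: trunc R w F = b *: trunc R w F -> a = b.
Proof.
move=> uF nw ab; have [[e ew eF]|nE] := pselect (exists2 e, src e = w & e \notin F).
  apply: (@vertex_torsion_free _ _ (rng e)).
  have := congr1 (fun x => G e ** x ** X e) ab.
  by rewrite !lpa_scaleAr !lpa_scaleAl (ghost_trunc R uF ew) (negPf eF) mul_ge.
have FP e : src e = w -> e \in F by move=> ew; apply: contraT => eF; case: nE; exists e.
apply: (@vertex_torsion_free _ _ w); move: ab; suff -> : trunc R w F = V w by [].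
rewrite /trunc big_pred0 ?subr0 // => e; apply/negP => /eqP ew; apply: nw; split.
  by apply: sub_finite_set (finite_seq F) => f /FP.
by exists e.
Qed.

(** * Bounds from a function above f_I f_J and G whose pairs at r are those below Q *)

Section SaturatedBound.
Variables (f : admissible_star E -> set R) (r : R) (Q : admissible E).
Hypotheses (hf : forall P, ideal_mul *%R (pair_f I P) (pair_f J P) `<=` f P)
  (hG : forall P, Gc (pair_g I) (pair_g J) P `<=` f P)
  (hQ : forall P, f P r <-> admissible_le (sval P) Q).

(** If a cycle of C_u(E) is based at u, then G supplies r. Otherwise a separating path leaves only
    diagonal terms, and r is a sum of products from f_I and f_J at the closure of u. *)
Lemma local_product_vertex u : local_product I J u (V u) (r *: V u) -> adH Q u.
Proof.
move=> loc; have [[d hd Cd]|nC] := pselect (exists2 d, simple_at u d & Cu d).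
  have [d0 pd] := simple_at_epath hd.
  have ud : path_vertices d u.
    by case: (d) d0 pd => // e p _ /andP[/eqP <- _]; exists e; rewrite ?mem_head; first by []; left.
  pose P := adm_star (@star_of _ (adm_closure (path_vertices d)) _ (or_introl (sub_closure ud))).
  suff /hQ/adm_closure_le/(_ _ ud) : f P r by [].
  apply: hG; right; exists d; split=> //.
  apply: (local_product_cycle idI idJ Cd d0 pd).
  by rewrite (lpa_eval_lconst d0 pd).
have su : [set u] u by [].
pose P := adm_star (@star_of _ (adm_closure [set u]) _ (or_introl (sub_closure su))).
suff /hQ/adm_closure_le/(_ _ su) : f P r by [].
have [D [/allP eD hD]] := local_product_diagonal idI idJ loc.
have [|t ht tP] := separating_path (u := u) _ (\sum_(x <- D) size x.2).
  by move=> d hd Cd; apply: nC; exists d.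
have sD x : x \in D -> (size x.2 <= \sum_(x <- D) size x.2)%N.
  by move=> xD; rewrite (big_rem x) //= leq_addr.
have [|||s] := hD (gel R u t) (pel R u t) (V u).
- exact: mul_gel_v ht.
- exact: mul_v_pel ht.
- move=> x y xD yD; have hx : epath x.1 x.2 u := eD _ xD.
  have hy : epath y.1 y.2 u := eD _ yD.
  rewrite -(gel_cat R hx ht) -lpa_mulA -(pel_cat R hy ht).
  have hxt : epath x.1 (x.2 ++ t) u by rewrite (epath_cat _ _ hx).
  have hyt : epath y.1 (y.2 ++ t) u by rewrite (epath_cat _ _ hy).
  case: eqVneq => [<-|ne]; first exact: gel_pel hxt.
  have [xy|nxy] := eqVneq x.1 y.1; last exact: (gel_pel_start R hxt hyt).
  have ne2 : x.2 != y.2.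
    by apply: contra ne => /eqP e2; apply/eqP; case: (x) (y) xy e2 => [? ?] [? ?] /= -> ->.
  rewrite -xy in hy hyt *.
  have /andP[n1 n2] := tP _ _ _ hx hy ne2 (sD _ xD) (sD _ yD).
  exact: gel_pel_incomparable hxt hyt n1 n2.
rewrite lpa_scaleAr lpa_scaleAl (mul_gel_v R ht) (gel_pel R ht) => /vertex_torsion_free <-.
move=> hs; apply: hf; move: r hs; apply: ideal_mul_sub => a ha;
  apply/pair_fP/adm_closure_le => // _ ->; exact: ha.
Qed.

(** The set F is enlarged twice: to F', which localizes, and to F2, which contains all edges of the
    paths that remain. Then [trunc w F2] annihilates the products of distinct paths. *)
Lemma trunc_mem_bound w F : uniq F -> ~ regular w -> IJ (r *: trunc R w F) ->
  (adH Q `|` adS Q) w.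
Proof.
move=> uF nw hr; have [F1 hF1] := trunc_localization idI idJ w hr.
pose F' := undup (F ++ F1); have uF' : uniq F' by exact: undup_uniq.
have FF' : {subset F <= F'} by move=> e; rewrite mem_undup mem_cat => ->.
have [|t loc tE] := hF1 F' uF'.
  by move=> e; rewrite mem_undup mem_cat orbC => ->.
have [D [/allP eD hD]] := local_product_diagonal idI idJ loc.
pose F2 := undup (F' ++ flatten [seq x.2 | x <- D]); have uF2 : uniq F2 by exact: undup_uniq.
have F'F2 : {subset F' <= F2} by move=> e he; rewrite mem_undup mem_cat he.
have DF2 x e : x \in D -> e \in x.2 -> e \in F2.
  move=> xD ex; rewrite mem_undup mem_cat; apply/orP; right.
  by apply/flattenP; exists x.2 => //; apply: map_f.
have idem : trunc R w F2 ** trunc R w F2 = trunc R w F2 by exact: trunc_truncr.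
have killl x e q : x \in D -> epath w (e :: q) w -> e \in x.2 -> trunc R w F2 ** pel R w (e :: q) = 0.
  move=> xD /andP[/eqP ew _] ex.
  by rewrite /= lpa_mulA (trunc_edge R uF2 ew) (DF2 _ _ xD ex) lpa_mul0l.
have killr x e q : x \in D -> epath w (e :: q) w -> e \in x.2 -> gel R w (e :: q) ** trunc R w F2 = 0.
  move=> xD /andP[/eqP ew _] ex.
  by rewrite /= -lpa_mulA (ghost_trunc R uF2 ew) (DF2 _ _ xD ex) lpa_mul0r.
have [|||s] := hD (trunc R w F2) (trunc R w F2) (trunc R w F2).
- exact: trunc_truncl.
- exact: trunc_truncr.
- move=> x y xD yD; have hx : epath x.1 x.2 w := eD _ xD.
  have hy : epath y.1 y.2 w := eD _ yD.
  rewrite -(lpa_mulA (trunc R w F2)) /ge /pe.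
  case: eqVneq => [<-|ne]; first by rewrite (gel_pel R hx) trunc_v idem.
  have [xy|nxy] := eqVneq x.1 y.1; last first.
    by rewrite (gel_pel_start R hx hy nxy) lpa_mul0r lpa_mul0l.
  have ne2 : x.2 != y.2.
    by apply: contra ne => /eqP e2; apply/eqP; case: (x) (y) xy e2 => [? ?] [? ?] /= -> ->.
  rewrite /ends -xy in hy *.
  have [/prefixP[[|e q] yE]|n1] := boolP (prefix x.2 y.2).
  + by case/eqP: ne2; rewrite yE cats0.
  + have hq : epath w (e :: q) w by move: hy; rewrite yE (epath_cat _ _ hx).
    rewrite yE (gel_pel_cat R hx hq) (killl y) ?lpa_mul0l //.
    by rewrite yE mem_cat mem_head orbT.
  have [/prefixP[[|e q] xE]|n2] := boolP (prefix y.2 x.2).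
  + by case/eqP: ne2; rewrite xE cats0.
  + have hq : epath w (e :: q) w by move: hx; rewrite xE (epath_cat _ _ hy).
    rewrite xE (gel_cat_pel R hy hq) -lpa_mulA (killr x) ?lpa_mul0r //.
    by rewrite xE mem_cat mem_head orbT.
  by rewrite (gel_pel_incomparable R hx hy n1 n2) lpa_mul0r lpa_mul0l.
have -> : trunc R w F2 ** t ** trunc R w F2 = r *: trunc R w F2.
  transitivity (trunc R w F2 ** (trunc R w F' ** t ** trunc R w F') ** trunc R w F2).
    rewrite !lpa_mulA (trunc_truncl R w uF2 F'F2) -[RHS]lpa_mulA.
    by rewrite (trunc_truncr R w uF2 F'F2).
  rewrite -tE !(lpa_scaleAr, lpa_scaleAl); congr (_ *: _).
  rewrite (trunc_truncl R w uF' FF') (trunc_truncr R w uF' (fun e => id)).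
  by rewrite (trunc_truncl R w uF2 F'F2).
move=> /(trunc_torsion_free uF2 nw) <- hs.
(* The meet of S still contains w. By [scalar_trunc_mem] it lies below the scalar pair of each
   factor in the products that make up r. *)
pose S := [set U : admissible E | (adH U `|` adS U) w /\
  forall e, src e = w -> e \notin F2 -> adH U (rng e)].
have wS : (adH (adm_meet S) `|` adS (adm_meet S)) w.
  apply: mem_adm_meet; first by move=> U [].
  apply: sub_finite_set (finite_seq F2) => e [ew ne] /=.
  by apply: contraT => eF; case: ne => U [_]; exact.
pose P := adm_star (star_of wS).
have : f P r.
  apply: hf; move: r hs; apply: ideal_mul_sub => a ha;
    apply/pair_fP => //; apply: adm_meet_le; exact: scalar_trunc_mem ha.
by move/hQ => [leH leS]; have [/leH|/leS] := wS => //; left.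
Qed.

(** Ends of long paths from v are reached by localization, and saturation leads back along the paths
    to v. *)
Lemma vertex_mem_bound v : IJ (r *: V v) -> adH Q v.
Proof.
move=> hr; have [N hN] := path_localization idI idJ hr.
have [_ _ IJM] := ideal_mul_ideal idI idJ.
have corner m u : epath v m u -> gel R v m ** (r *: V v) ** pel R v m = r *: V u.
  by move=> hm; rewrite lpa_scaleAr lpa_scaleAl (mul_gel_v R hm) (gel_pel R hm).
(* Here k bounds the length that m still lacks for localization. *)
suff down k m u : epath v m u -> (N <= size m + k)%N -> adH Q u.
  by apply: (down N [::] v); rewrite ?add0n //= eqxx.
elim: k m u => [|k IH] m u hm sm.
  apply: local_product_vertex; rewrite -(corner _ _ hm); apply: hN => //.
  by rewrite addn0 in sm.
have out e : src e = u -> adH Q (rng e).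
  move=> eu; apply: (IH (rcons m e)); last by rewrite size_rcons addSnnS.
  by rewrite -cats1 (epath_cat _ _ hm) /= eu !eqxx.
have [ru|nu] := pselect (regular u); first by apply: (adH_saturated ru).
(* A vertex that is not regular is its own truncation by the empty list. It cannot break [adH Q], as
   all its edges have their ranges there. *)
have : IJ (r *: trunc R u [::]).
  by rewrite trunc_nil -(corner _ _ hm); apply: (IJM _ _ _).2; apply: (IJM _ _ _).1.
case/trunc_mem_bound => // /adS_breaking[_ _ [e [eu ne]] _].
by case: ne; exact: out.
Qed.

Lemma pair_f_product_bound (P : admissible_star E) : pair_f IJ P r -> f P r.
Proof.
move=> [hH hS]; apply/hQ; split=> [v /hH|w Sw]; first exact: vertex_mem_bound.
have [inf _ _ /emitted_outside_enum[F uF FP]] := adS_breaking Sw.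
apply: (trunc_mem_bound uF); first by case.
by rewrite -(lpa_breakingE R uF FP); exact: hS.
Qed.

End SaturatedBound.

(** Vertices and the elements w^H are idempotents x, so (ab) x is the product of a x and b x. *)
Lemma pair_f_mul_sub (P : admissible_star E) :
  ideal_mul *%R (pair_f I P) (pair_f J P) `<=` pair_f IJ P.
Proof.
have idP := pair_f_ideal (ideal_mul_ideal idI idJ) P.
apply: ideal_mul_ind; first by case: idP.
  by move=> x y; exact: (ideal_closedD idP).
have key a b x : x ** x = x -> I (a *: x) -> J (b *: x) -> IJ ((a * b) *: x).
  move=> xx Ix Jx; rewrite -xx -scalerA.
  by rewrite -lpa_scaleAr -lpa_scaleAl; exact: ideal_mul_gen.
move=> a b [aH aS] [bH bS]; split=> [v hv|w hw].
  by apply: key; [exact: mul_vv|exact: aH|exact: bH].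
apply: key; [|exact: aS|exact: bS].
have [_ _ _ /emitted_outside_enum[F uF FP]] := adS_breaking hw.
by rewrite (lpa_breakingE R uF FP); exact: trunc_truncr.
Qed.

(** Evaluating the constant r at c gives r u in IJ at the base u of c. Heredity spreads this along
    c, and saturation to the closure of its vertices. *)
Lemma Gc_sub (P : admissible_star E) : Gc (pair_g I) (pair_g J) P `<=` pair_f IJ P.
Proof.
have idIJ := ideal_mul_ideal idI idJ.
move=> r [->|[c [Cc PH PS hr]]]; first by case: (pair_f_ideal idIJ P).
have [u [c0 hc]] := Cu_epath Cc.
have := pair_g_ideal_mul c0 hc idI idJ hr.
rewrite /pair_g /= (lpa_eval_lconst c0 hc) => ru.
apply/pair_fP => //; split; last by rewrite PS.
rewrite PH; apply: closure_sub => w [e ec].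
have her := scalar_hereditaryP idIJ (r := r).
have [p1 [p2 cE]] : exists p1 p2, c = p1 ++ e :: p2.
  by case/splitPr: ec => p1 p2; exists p1, p2.
have [h1 _] : epath u p1 (src e) /\ epath (src e) (e :: p2) u.
  by apply: epath_src; rewrite -cE.
have Hu : scalar_hereditary (ideal_mul (@lpa_mul R E) I J) r u by [].
have Hs : scalar_hereditary (ideal_mul (@lpa_mul R E) I J) r (src e).
  elim: p1 u Hu h1 {hc ru cE} => [|g p IH] v Hv /=; first by move/eqP <-.
  case/andP=> /eqP gv; apply: IH; move/hereditary_edge: her; apply.
  by rewrite gv.
by case=> ->; [exact: Hs|move/hereditary_edge: her; exact].
Qed.

End ProductOfIdeals.

Unset Implicit Arguments.

Theorem proposition6p24 (R : comPzRingType) (E : digraph)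
    (I J : set (lpa R E))
    (idealI : ideal (@lpa_mul R E) I) (idealJ : ideal (@lpa_mul R E) J) :
  let IJ := ideal_mul (@lpa_mul R E) I J in
  pair_f IJ =
    saturation (fun P =>
      ideal_add (ideal_mul *%R (pair_f I P) (pair_f J P))
                (Gc (pair_g I) (pair_g J) P)) /\
  (forall c : seq (edge E), Cu c ->
    pair_g IJ c = ideal_mul *%R (pair_g I c) (pair_g J c)).
Proof.
move=> IJ; have idIJ := ideal_mul_ideal idealI idealJ; split; last first.
  move=> c Cc; rewrite eqEsubset; split; first exact: pair_g_product.
  have [u [c0 hc]] := Cu_epath Cc; exact: (pair_g_ideal_mul c0 hc).
set h := (fun P => ideal_add _ _).
have [sat_h le_h min_h] := saturationP h.
apply/funext => P; rewrite eqEsubset; split=> r; last first.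
  (* The function of IJ is itself saturated, so minimality requires only that it contain both
     summands. *)
  apply: min_h r; first exact: pair_f_saturated.
  move=> {}P _ [x [y [hx hy ->]]].
  apply: (ideal_closedD (pair_f_ideal idIJ P)); first exact: pair_f_mul_sub.
  exact: Gc_sub hy.
(* For fixed r the saturation enters only through the pair Q that bounds the pairs where it contains
   r. *)
have [Q hQ] := saturated_fun_principal sat_h r.
apply: (pair_f_product_bound idealI idealJ _ _ hQ) => {}P s hs; apply: le_h.
  by exists s, 0; rewrite addr0; split=> //; left.
by exists 0, s; rewrite add0r; split=> //; exact: ideal_mul0.
Qed.
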